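(* Let $X$ be a real Banach space. Then $X$ has the weak approximate fixed point property if and only if $X$ contains no isomorphic copy of $\ell_1$ (i.e. no subspace of $X$ is linearly homeomorphic to $\ell_1$).
   Context: A nonempty closed convex bounded subset $C$ of a real Banach space is said to have the weak approximate fixed point property if for every (norm-)continuous mapping $f:C\to C$ there is a sequence $\{x_n\}$ in $C$ such that the sequence $\{x_n-f(x_n)\}$ weakly converges to $0$. A Banach space $X$ is said to have the weak approximate fixed point property if each nonempty closed convex bounded subset of $X$ has the weak approximate fixed point property. Here ''closed'' and ''bounded'' refer to the norm. *)

(* Defs.v *)
From HB Require Import structures.
From mathcomp Require Import all_boot all_order all_algebra.
From mathcomp Require Import all_classical all_reals all_analysis.

Set Implicit Arguments.
Unset Strict Implicit.
Unset Printing Implicit Defensive.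

Import Order.TTheory GRing.Theory Num.Theory.
Import numFieldNormedType.Exports.

Local Open Scope classical_set_scope.
Local Open Scope ring_scope.

(* The space ell_1 of absolutely summable real sequences, with the norm
   a |-> \sum_n |a_n|. *)
Section EllOne.
Variable R : realType.

Definition abs_summable : {pred nat -> R^o} :=
  mem [set a : nat -> R^o | cvgn [series `|a n|]_n].

Lemma abs_summableP (a : nat -> R^o) :
  (a \in abs_summable) = (cvgn [series `|a n|]_n) :> Prop.
Proof. by apply/propext; split; [move/set_mem|move/mem_set]. Qed.

Lemma abs_summableZD (k : R) (a b : nat -> R^o) :
  cvgn [series `|a n|]_n -> cvgn [series `|b n|]_n ->
  cvgn [series `|(k *: a + b) n|]_n.
Proof.
move=> ca cb.
apply: (@series_le_cvg _ _
  (`|k| *: (fun n => `|a n| : R^o) + (fun n => `|b n| : R^o))) => [n|n|n|] //=.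
- by rewrite addr_ge0 ?mulr_ge0.
- by rewrite (le_trans (ler_normD _ _))// normrZ.
- by apply: is_cvg_seriesD => //; exact: is_cvg_seriesZ.
Qed.

Lemma abs_summable_submod_closed : submod_closed abs_summable.
Proof.
split=> [|k a b]; rewrite !abs_summableP; last exact: abs_summableZD.
rewrite (_ : series _ = cst 0); first exact: is_cvg_cst.
by apply/funext => n; rewrite seriesEnat /= big1// => i _; rewrite normr0.
Qed.

HB.instance Definition _ :=
  GRing.isSubmodClosed.Build R (nat -> R^o) abs_summable
    abs_summable_submod_closed.

Record ell1 := Ell1 {
  ell1_val :> nat -> R^o;
  ell1_valP : ell1_val \in abs_summable }.

HB.instance Definition _ := [isSub for ell1_val].
HB.instance Definition _ := [Choice of ell1 by <:].
HB.instance Definition _ := [SubChoice_isSubLmodule of ell1 by <:].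

Definition ell1_norm (a : ell1) : R := limn [series `|a n|]_n.

Lemma ell1_cvg (a : ell1) : cvgn [series `|a n|]_n.
Proof. by have := ell1_valP a; rewrite abs_summableP. Qed.

Lemma ell1_normD (a b : ell1) : ell1_norm (a + b) <= ell1_norm a + ell1_norm b.
Proof.
rewrite /ell1_norm -lim_seriesD; [|exact: ell1_cvg..].
apply: lim_series_le => [||n]; first exact: ell1_cvg.
- by apply: is_cvg_seriesD; exact: ell1_cvg.
- exact: ler_normD.
Qed.

Lemma ell1_normZ (k : R) (a : ell1) : ell1_norm (k *: a) = `|k| * ell1_norm a.
Proof.
rewrite /ell1_norm -[RHS]/(`|k| *: (_ : R^o)) -lim_seriesZ; last exact: ell1_cvg.
by congr (limn (series _)); apply/funext => n; exact: normrZ.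
Qed.

Lemma ell1_norm0_eq0 (a : ell1) : ell1_norm a = 0 -> a = 0.
Proof.
move=> a0; apply/val_inj/funext => n /=; apply/eqP.
rewrite -normr_le0.
have nda : nondecreasing_seq [series `|a n|]_n.
  by apply: nondecreasing_series => i _ _; exact: normr_ge0.
have := nondecreasing_cvgn_le nda (@ell1_cvg a) n.+1.
rewrite -/(ell1_norm a) a0; apply: le_trans.
by rewrite seriesEnat/= big_nat_recr//= lerDr sumr_ge0.
Qed.

HB.instance Definition _ :=
  Lmodule_isNormed.Build R ell1 ell1_normD ell1_normZ ell1_norm0_eq0.

End EllOne.

Section WeakApproximateFixedPoints.
Variables (R : realType) (X : normedModType R).

Definition weakly_cvg (u : nat -> X) (x : X) :=
  forall phi : {linear X -> R^o}, continuous phi ->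
    phi (u n) @[n --> \oo] --> phi x.

(* A self-map of C is represented by a map of X sending C to C; its values
   outside C are irrelevant. *)
Definition weak_afpp_on (C : set X) :=
  forall f : X -> X, set_fun C C f -> {within C, continuous f} ->
    exists u : nat -> X,
      (forall n, C (u n)) /\ weakly_cvg (fun n => u n - f (u n)) 0.

Definition weak_afpp :=
  forall C : set X, C !=set0 -> closed C -> convex_set C -> bounded_set C ->
    weak_afpp_on C.

End WeakApproximateFixedPoints.

Arguments weak_afpp {R} X.

Section IsomorphicCopies.
Variables (R : realType) (E F : normedModType R).

(* T is a linear homeomorphism of E onto Y, with inverse S; the values of S
   outside Y are irrelevant. *)
Definition linearly_homeomorphic_to (Y : set F) :=
  exists (T : {linear E -> F}) (S : F -> E),
    [/\ range T = Y, continuous T, cancel T S & {within Y, continuous S}].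

Definition contains_isomorphic_copy :=
  exists Y : set F, submod_closed (mem Y) /\ linearly_homeomorphic_to Y.

End IsomorphicCopies.

Arguments contains_isomorphic_copy {R} E F.

(* Main.v *)
(** Let [X] contain no copy of [l1], and let [f] be a continuous self-map of
    [C]. Scarf's combinatorial lemma yields Brouwer's theorem, which gives, for
    finitely many functionals [phi i] and [e > 0], a point [x] of [C] with
    [|phi i (x - f x)| <= e]. By compactness of the powers of the dual ball,
    there are a sequence [x] in [C] and a nonprincipal ultrafilter [U] on [nat]
    along which [a n = x n - f (x n)] tends weakly to [0]. A Ramsey argument for
    trees whose branching sets belong to [U] shows that either some sequence
    [a (m i)] is weakly null, or, for some [e > 0], there is a sequence
    [a (y i)] such that every pattern of inequalities [phi (a (y i)) >= e] and
    [phi (a (y i)) <= e / 2], [i < n], is realized by some [phi] of norm at most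
    [1]; in the latter case [a (y i)] is equivalent to the basis of [l1].

    Conversely, a ball of [l1] has a continuous self-map displacing every point
    by at least [1 / 8]: it sends [a] to the point of parameter [t] on the
    polygonal path through the unit vectors, where [t] exceeds the index of
    every large coordinate of [a]. By the Hahn-Banach theorem, weak convergence
    to [0] in [X] of a sequence of the copy of [l1] implies its weak convergence
    in [l1], hence its norm convergence by Schur's theorem. *)
From HB Require Import structures.
Require Import Defs.
From mathcomp Require Import all_boot all_order all_algebra.

Set Implicit Arguments.
Unset Strict Implicit.
Unset Printing Implicit Defensive.

(** * Scarf's lemma *)

Lemma subset_cardS (T : finType) (W Z : {set T}) : W \subset Z ->
  #|Z| = #|W|.+1 -> exists2 x, x \notin W & Z = x |: W.
Proof.
move=> WZ cZ; have /cards1P[x Zx] : #|Z :\: W| == 1.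
  by rewrite cardsD (setIidPr WZ) cZ subSnn.
exists x; last by rewrite -Zx setUC -{1}(setID Z W) (setIidPr WZ).
by have : x \in Z :\: W; [rewrite Zx set11|rewrite inE => /andP[]].
Qed.

(* [V] consists of points and of one slack element [s i] for each [i], which is
   least for [r i] and, for the other ranks, greater than all points. Every
   dominating set with [#|I| - 1] elements (a door) lies in exactly two
   dominating sets with [#|I|] elements (rooms), except those made of slack
   elements only, which lie in one; a Sperner parity count follows. *)
Section Scarf.
Variables (I V : finType) (r : I -> V -> nat) (s : I -> V) (c : V -> I).
Hypothesis r_inj : forall i, injective (r i).
Hypothesis s_min : forall i v, r i (s i) <= r i v.
Hypothesis s_large : forall i k v,
  v \notin codom s -> k != i -> r i v < r i (s k).
Hypothesis sK : cancel s c.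
Variable t0 : V.
Hypothesis t0P : t0 \notin codom s.

(** Scarf's condition on primitive sets: for nonempty [Z], no [y] exceeds the minimum of [Z] in all
    ranks at once. *)
Definition dominating (Z : {set V}) :=
  [forall y, exists i, forall z in Z, r i y <= r i z].

Definition argmin_in (i : I) (Z : {set V}) : V :=
  odflt t0 [pick z in Z | [forall z' in Z, r i z <= r i z']].

Local Notation mn := argmin_in.

Lemma dominatingP (Z : {set V}) :
  reflect (forall y, exists i, forall z, z \in Z -> r i y <= r i z)
          (dominating Z).
Proof.
apply: (iffP forallP) => H y; have := H y.
  by move=> /existsP[i /forall_inP Hi]; exists i.
by move=> [i Hi]; apply/existsP; exists i; apply/forall_inP.
Qed.

Lemma dominating_sub (W Z : {set V}) :
  W \subset Z -> dominating Z -> dominating W.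
Proof.
move=> /subsetP WZ /dominatingP dZ; apply/dominatingP => y.
by have [i Hi] := dZ y; exists i => z /WZ /Hi.
Qed.

Lemma argmin_inP i (Z : {set V}) z0 : z0 \in Z ->
  mn i Z \in Z /\ forall z, z \in Z -> r i (mn i Z) <= r i z.
Proof.
move=> z0Z; rewrite /argmin_in; case: pickP.
  by move=> z /andP[zZ /forall_inP zm].
move=> none.
have := none [arg min_(z < z0 in Z) r i z]; case: arg_minnP => // z -> zm /=.
by move=> /negbT/forall_inPn[z' z'Z]; rewrite zm.
Qed.

Lemma argmin_in_uniq i (Z : {set V}) z :
  z \in Z -> (forall z', z' \in Z -> r i z <= r i z') -> mn i Z = z.
Proof.
move=> zZ zm; have [mZ mm] := argmin_inP i zZ.
by apply: (r_inj (i := i)); apply/eqP; rewrite eqn_leq mm// zm.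
Qed.

(** Domination tested at [z] itself gives a rank that [z] minimizes over [Z]. Hence [I] maps onto
    any nonempty dominating set. *)
Lemma dominating_argmin (Z : {set V}) z :
  dominating Z -> z \in Z -> exists i, mn i Z = z.
Proof.
by move=> /dominatingP /(_ z) [i iz] zZ; exists i; exact: argmin_in_uniq.
Qed.

Lemma dominating_imset (Z : {set V}) z0 :
  dominating Z -> z0 \in Z -> (mn^~ Z) @: [set: I] = Z.
Proof.
move=> dZ z0Z; apply/setP => z; apply/imsetP/idP => [[i _ ->]|zZ].
  by have [] := argmin_inP i z0Z.
by have [i <-] := dominating_argmin dZ zZ; exists i.
Qed.

(** Candidates to enlarge [W] without changing its minimizers in the ranks other than [k]. *)
Definition above (k : I) (W : {set V}) : {set V} :=
  [set y | [forall l, (l != k) ==> (r l (mn l W) < r l y)]].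

Lemma aboveP k (W : {set V}) y :
  reflect (forall l, l != k -> r l (mn l W) < r l y) (y \in above k W).
Proof.
rewrite inE; apply: (iffP forallP) => H l; last by apply/implyP; exact: H.
by move=> lk; have /implyP/(_ lk) := H l.
Qed.

Definition is_top (k : I) (W : {set V}) (x : V) :=
  x \in above k W /\ forall y, y \in above k W -> r k y <= r k x.

Lemma is_top_uniq k W x x' : is_top k W x -> is_top k W x' -> x = x'.
Proof.
move=> [xa xm] [x'a x'm]; apply: (r_inj (i := k)).
by apply/eqP; rewrite eqn_leq xm// x'm.
Qed.

Lemma is_top_ex k W y : y \in above k W -> exists x, is_top k W x.
Proof.
move=> ya; exists [arg max_(x > y in above k W) r k x].
by case: arg_maxnP => // x xa xm; split.
Qed.

(** As [j] and [k] share their minimizer, rank [k] is free to be minimized by a new element. The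
    candidate highest in rank [k] leaves no [y] above the enlarged set. *)
Lemma room_of_top k j (W : {set V}) w0 x : w0 \in W -> dominating W ->
  j != k -> mn j W = mn k W -> is_top k W x ->
  x \notin W /\ dominating (x |: W).
Proof.
move=> w0W dW jk jkW [/aboveP xa xm]; split.
  apply/negP => xW; have [l lx] := dominating_argmin dW xW.
  have [lk|lk] := eqVneq l k; last by have := xa _ lk; rewrite lx ltnn.
  by have := xa _ jk; rewrite jkW -lk lx ltnn.
have xk z : z \in W -> r k x <= r k z.
  move: (dW) => /dominatingP /(_ x)[l lx] zW.
  have [<-|lk] := eqVneq l k; first exact: lx.
  have [mW _] := argmin_inP l w0W.
  by have := xa _ lk; rewrite ltnNge lx.
apply/dominatingP => y; have [ya|] := boolP (y \in above k W).
  exists k => z /setU1P[->|zW]; first exact: xm.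
  by rewrite (leq_trans (xm _ ya))// xk.
rewrite inE => /forallPn[l]; rewrite negb_imply -leqNgt => /andP[lk yl].
have [_ mm] := argmin_inP l w0W.
exists l => z /setU1P[->|zW]; last by rewrite (leq_trans yl)// mm.
by rewrite (leq_trans yl)// ltnW// xa.
Qed.

(** By counting, the minimizer map of the room [x |: W] is a bijection from [I]. With [k] the index
    of [x], all other ranks are minimized inside [W], and domination of the room makes [x] the top
    candidate. *)
Lemma top_of_room (W : {set V}) w0 x : w0 \in W -> #|W|.+1 = #|I| ->
  x \notin W -> dominating (x |: W) ->
  exists2 k, {in [set~ k] &, injective (mn^~ W)} & is_top k W x.
Proof.
move=> w0W cW xW dZ; pose Z := x |: W.
have xZ : x \in Z by rewrite !inE eqxx.
have sW z : z \in W -> z \in Z by rewrite !inE => ->; rewrite orbT.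
have im := dominating_imset dZ xZ.
have inj : {in [set: I] &, injective (mn^~ Z)}.
  by apply/imset_injP; rewrite im cardsU1 xW add1n cW cardsT.
have [k kx] := dominating_argmin dZ xZ.
have eqm l : l != k -> mn l Z = mn l W.
  move=> lk; have [mZ mm] := argmin_inP l xZ.
  apply/esym/argmin_in_uniq => [|z zW]; last exact/mm/sW.
  case/setU1P: mZ => // lx; case/eqP: lk.
  by apply: inj; rewrite ?inE// lx kx.
exists k => [l l'|].
  rewrite !inE => lk l'k; rewrite -!eqm// => e; exact: inj.
split=> [|y /aboveP ya].
  apply/aboveP => l lk; have [mZ mm] := argmin_inP l xZ.
  rewrite -eqm// ltn_neqAle mm// andbT; apply/eqP => /(@r_inj l) e.
  by case/eqP: lk; apply: inj; rewrite ?inE// e kx.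
move: dZ => /dominatingP /(_ y)[l ly].
have [<-|lk] := eqVneq l k; first exact: ly.
have := ya _ lk; rewrite -eqm// ltnNge.
by have [mZ _] := argmin_inP l xZ; rewrite ly.
Qed.

Definition room (Z : {set V}) := (#|Z| == #|I|) && dominating Z.

Definition rooms_over (W : {set V}) := [set Z | room Z & W \subset Z].

(** [I] maps onto [W], which has one element fewer, so exactly two indices collide and dropping
    either one restores injectivity. *)
Lemma coincident_pair (W : {set V}) w0 : w0 \in W -> #|W|.+1 = #|I| ->
  dominating W -> exists i j, [/\ i != j, mn i W = mn j W,
    {in [set~ i] &, injective (mn^~ W)} & {in [set~ j] &, injective (mn^~ W)}].
Proof.
move=> w0W cW dW; have im := dominating_imset dW w0W.
have /injectivePn[i [j ij e]] : ~~ injectiveb (mn^~ W).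
  apply/negP => /injectiveP inj; have := card_imset [set: I] inj.
  by rewrite im cardsT -cW => /eqP; rewrite ltn_eqF.
have aux k l : k != l -> mn k W = mn l W -> {in [set~ k] &, injective (mn^~ W)}.
  move=> kl e'; apply/imset_injP; rewrite cardsC1 -cW /=.
  apply/eqP; congr (#|pred_of_set _|); rewrite -[RHS]im; apply/setP => z.
  apply/imsetP/imsetP => -[m _ ->]; first by exists m.
  have [->|mk] := eqVneq m k; last by exists m; rewrite ?inE.
  by exists l => //; rewrite !inE eq_sym.
exists i, j; split => //; first exact: (aux i j).
by apply: (aux j i); rewrite // eq_sym.
Qed.

(** The index of the added element must be one of the two colliding ones, since injectivity off any
    other index fails. *)
Lemma mem_rooms_over (W : {set V}) w0 i j Z : w0 \in W -> #|W|.+1 = #|I| ->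
  dominating W -> i != j -> mn i W = mn j W ->
  reflect (exists k x, [/\ k \in [set i; j], is_top k W x & Z = x |: W])
    (Z \in rooms_over W).
Proof.
move=> w0W cW dW ij e; apply: (iffP idP).
  rewrite inE => /andP[/andP[/eqP cZ dZ] WZ].
  have [|x xW ZE] := subset_cardS WZ; first by rewrite cZ.
  rewrite ZE in dZ; have [k kin ktop] := top_of_room w0W cW xW dZ.
  exists k, x; split=> //; rewrite !inE; apply/negPn; rewrite negb_or.
  apply/negP => /andP[ki kj]; case/eqP: ij.
  by apply: kin; rewrite // !inE eq_sym.
move=> [k [x [kij xt ->]]].
have [xW dZ] : x \notin W /\ dominating (x |: W).
  move: kij; rewrite !inE => /orP[] /eqP ek; rewrite ek in xt.
    by apply: (room_of_top (j := j) w0W dW _ _ xt); rewrite 1?eq_sym.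
  exact: (room_of_top (j := i) w0W dW _ _ xt).
by rewrite inE /room dZ cardsU1 xW add1n cW eqxx subsetUr.
Qed.

(** Separates the two rooms over a door: a candidate for two distinct indices would exceed the
    minimum of [W] in every rank. *)
Lemma above_pair (W : {set V}) w0 i j x : w0 \in W -> dominating W ->
  x \in above i W -> x \in above j W -> i = j.
Proof.
move=> w0W dW /aboveP xi /aboveP xj; apply/eqP/negPn/negP => ij.
move: dW => /dominatingP /(_ x)[l lx].
have [mW _] := argmin_inP l w0W.
have [li|li] := eqVneq l i; last by have := xi _ li; rewrite ltnNge lx.
by have := xj l; rewrite li ij => /(_ isT); rewrite -li ltnNge lx.
Qed.

Lemma notin_topE k (W : {set V}) x : is_top k W x -> forall j w0,
  j != k -> mn j W = mn k W -> w0 \in W -> dominating W -> x \notin W.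
Proof.
by move=> xt j w0 jk e w0W dW; have [] := room_of_top w0W dW jk e xt.
Qed.

(** The point [v] keeps the minima of the door below the slack elements, so [s k] is a candidate for
    each colliding [k] and both rooms exist. *)
Lemma inner_door (W : {set V}) v : v \in W -> v \notin codom s ->
  #|W|.+1 = #|I| -> dominating W -> #|rooms_over W| = 2.
Proof.
move=> vW vs cW dW; have [i [j [ij e _ _]]] := coincident_pair vW cW dW.
have top k : exists x, is_top k W x.
  apply: (is_top_ex (y := s k)); apply/aboveP => l lk.
  have [_ mm] := argmin_inP l vW.
  by rewrite (leq_ltn_trans (mm _ vW))// s_large// eq_sym.
have [x xt] := top i; have [y yt] := top j.
have ji : j != i by rewrite eq_sym.
have xW : x \notin W by apply: (notin_topE xt ji _ vW dW).
suff -> : rooms_over W = [set x |: W; y |: W].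
  rewrite cards2; case: eqP => //= exy; exfalso.
  have : x \in y |: W by rewrite -exy !inE eqxx.
  rewrite !inE (negPf xW) orbF => /eqP xy; case/eqP: ij.
  case: xt yt => [xa _] [ya _]; apply: (above_pair vW dW xa).
  by rewrite xy.
apply/setP => Z; apply/(mem_rooms_over Z vW cW dW ij e)/set2P.
  move=> [k [z [/set2P[] -> zt ->]]]; [left|right]; congr (_ |: _).
    exact: is_top_uniq zt xt.
  exact: is_top_uniq zt yt.
move=> [->|->]; [exists i, x|exists j, y]; split => //.
  exact: set21.
exact: set22.
Qed.

Variable i0 : I.
Hypothesis I_gt1 : 1 < #|I|.

Definition outer_door : {set V} := s @: [set~ i0].

Lemma outer_door_dominating : dominating outer_door.
Proof.
apply/dominatingP => y; have [/codomP[q ->]|ys] := boolP (y \in codom s).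
  by exists q.
exists i0 => _ /imsetP[k ki ->]; rewrite !inE in ki.
by rewrite ltnW// s_large.
Qed.

Lemma outer_door_card : #|outer_door|.+1 = #|I|.
Proof.
rewrite card_imset; last exact: can_inj sK.
by rewrite cardsC1 prednK// ltnW.
Qed.

(** The colliding indices are [i0] and the [p] for which [s p] is least in rank [i0]. A candidate
    for [p] must exceed [s p] in rank [i0], hence be some [s q] with [q] other than [i0] and [p],
    but it cannot exceed itself in rank [q]. *)
Lemma outer_door_rooms : #|rooms_over outer_door| = 1.
Proof.
set W := outer_door.
have s_inj : injective s := can_inj sK.
have [w0 w0W] : exists w0, w0 \in W.
  by apply/set0Pn; rewrite -card_gt0 -ltnS outer_door_card.
have mnE l : l != i0 -> mn l W = s l.
  move=> li; apply: argmin_in_uniq => // .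
  by apply/imsetP; exists l; rewrite ?inE.
have [/imsetP[p pi mp] mm] := argmin_inP i0 w0W.
rewrite !inE in pi.
have e : mn i0 W = mn p W by rewrite mp mnE.
have ip : i0 != p by rewrite eq_sym.
have dW := outer_door_dominating; have cW := outer_door_card.
have [x xt] : exists x, is_top i0 W x.
  apply: (is_top_ex (y := t0)); apply/aboveP => l li.
  rewrite mnE// ltn_neqAle s_min andbT; apply/eqP => /(@r_inj l) st.
  by move: t0P; rewrite -st codom_f.
suff -> : rooms_over W = [set x |: W] by rewrite cards1.
apply/setP => Z; apply/(mem_rooms_over Z w0W cW dW ip e)/set1P; last first.
  by move=> ->; exists i0, x; rewrite set21.
move=> [k [z [/set2P[] -> zt ->]]]; first by rewrite (is_top_uniq zt xt).
have [/aboveP za _] := zt; have := za _ ip; rewrite mp.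
have [/codomP[q zq]|zs] := boolP (z \in codom s); last first.
  by rewrite ltnNge ltnW// s_large.
have [qp|qp] := eqVneq q p; first by rewrite zq qp ltnn.
have := za _ qp; rewrite zq; have [->|qi] := eqVneq q i0.
  by rewrite ltnNge s_min.
by rewrite mnE// ltnn.
Qed.

Definition i0_doors :=
  [set W : {set V} | [&& #|W|.+1 == #|I|, dominating W & c @: W == [set~ i0]]].

Lemma door_inside_inj (W : {set V}) :
  #|W|.+1 = #|I| -> c @: W = [set~ i0] -> {in W &, injective c}.
Proof.
by move=> cW e; apply/imset_injP; rewrite e cardsC1 -cW.
Qed.

(** If such a room contains a member of [i0_doors], one color occurs twice in it, and deleting
    either element of that pair gives the only two such doors. *)
Lemma doors_under_even (Z : {set V}) : room Z -> c @: Z != [set: I] ->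
  ~~ odd #|[set W in i0_doors | W \subset Z]|.
Proof.
move=> /andP[/eqP cZ dZ] colZ.
have [->|[W]] := set_0Vmem [set W in i0_doors | W \subset Z].
  by rewrite cards0.
rewrite !inE => /andP[/and3P[/eqP cW dW /eqP iW] WZ].
have [|z zW ZE] := subset_cardS WZ; first by rewrite cZ.
have cz : c z != i0.
  apply: contra colZ => /eqP cz; apply/eqP/setP => i; rewrite inE.
  have [->|ii] := eqVneq i i0.
    by apply/imsetP; exists z; rewrite // ZE !inE eqxx.
  have : i \in c @: W by rewrite iW !inE.
  move=> /imsetP[w wW ->]; apply/imsetP; exists w => //.
  by rewrite (subsetP WZ).
have : c z \in c @: W by rewrite iW !inE.
move=> /imsetP[w wW zw].
have Winj := door_inside_inj cW iW.
have wZ := subsetP WZ _ wW.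
have wz : w != z by apply: contraNneq zW => <-.
have cZw : c @: (Z :\ w) = [set~ i0].
  rewrite -iW; apply/setP => i; apply/imsetP/imsetP => -[u].
    rewrite ZE !inE => /andP[uw /orP[/eqP ->|uW]] ->; last by exists u.
    by exists w.
  move=> uW ->; have [->|uw] := eqVneq u w.
    by exists z; rewrite // ZE !inE eqxx eq_sym wz.
  by exists u; rewrite // ZE !inE uw uW orbT.
suff -> : [set W in i0_doors | W \subset Z] = [set W; Z :\ w].
  rewrite cards2; case: eqP => //= WE.
  by move: wW; rewrite WE !inE eqxx.
apply/setP => W'; apply/idP/set2P; last first.
  move=> [->|->]; first by rewrite !inE cW eqxx dW iW eqxx WZ.
  have cZw1 : #|Z :\ w|.+1 = #|I| by rewrite -cZ (cardsD1 w Z) wZ.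
  rewrite !inE cZw1 eqxx cZw eqxx subsetDl !andbT /=.
  exact: dominating_sub (subsetDl _ _) dZ.
rewrite !inE => /andP[/and3P[/eqP cW' dW' /eqP iW'] W'Z].
have [|u uW' ZE'] := subset_cardS W'Z; first by rewrite cZ.
have W'E : W' = Z :\ u by rewrite ZE' setU1K.
have uZ : u \in Z by rewrite ZE' setU11.
move: uZ; rewrite ZE => /setU1P[uz|uW].
  by left; rewrite W'E uz ZE setU1K.
right; rewrite W'E ZE; suff -> : u = w by [].
have : c u \in c @: W' by rewrite iW' -iW imset_f.
move=> /imsetP[u']; rewrite W'E ZE !inE => /andP[u'u /orP[/eqP ->|u'W]] cu.
  by apply: Winj; rewrite // cu zw.
by case/eqP: u'u; apply: Winj.
Qed.

(** Without such a room, the incidences between rooms and [i0_doors] are even in number when counted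
    by rooms. Counted by doors they are odd, since [outer_door] lies in one room and the others in
    two. *)
Lemma colorful_room : exists2 Z, dominating Z & c @: Z = [set: I].
Proof.
case: (boolP [exists Z, dominating Z && (c @: Z == [set: I])]).
  by move=> /existsP[Z /andP[dZ /eqP cZ]]; exists Z.
move=> /existsPn none; exfalso.
have even_rooms :
    ~~ odd (\sum_(Z | room Z) #|[set W in i0_doors | W \subset Z]|).
  rewrite (big_morph odd oddD (erefl : odd 0 = false)).
  apply: (big_ind (fun b => ~~ b)) => [//|[] [] //|Z Zr].
  apply: doors_under_even => //; have := none Z.
  by case/andP: Zr => _ ->.
have swap : \sum_(Z | room Z) #|[set W in i0_doors | W \subset Z]| =
            \sum_(W in i0_doors) #|rooms_over W|.
  transitivity (\sum_(Z | room Z) \sum_(W in i0_doors) (W \subset Z : nat)).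
    apply: eq_bigr => Z _; rewrite -sum1_card big_mkcond /= [RHS]big_mkcond /=.
    apply: eq_bigr => W _; rewrite in_set.
    by case: (W \in i0_doors); case: (W \subset Z).
  rewrite exchange_big /=; apply: eq_bigr => W _.
  rewrite -sum1_card big_mkcond /= [RHS]big_mkcond /=.
  by apply: eq_bigr => Z _; rewrite in_set; case: (room Z); case: (W \subset Z).
have W0 : outer_door \in i0_doors.
  rewrite !inE outer_door_card eqxx outer_door_dominating /=.
  rewrite /outer_door -imset_comp; apply/eqP; rewrite -[RHS]imset_id.
  by apply: eq_imset => i /=; rewrite sK.
move: even_rooms; rewrite swap (bigD1 _ W0) /= outer_door_rooms oddD /=.
move=> /negPn; apply/negP; rewrite (big_morph odd oddD (erefl : odd 0 = false)).
apply: (big_ind (fun b => ~~ b)) => [//|[] [] //|W /andP[WD Wn0]].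
have {WD} : W \in i0_doors := WD; rewrite in_set => /and3P[/eqP cW dW /eqP iW].
(* A member of [i0_doors] made of slack elements only must be [outer_door], because [c] recovers the
   index of a slack element. *)
have [/subsetP Ws|/subsetPn[v vW vs]] := boolP (W \subset codom s); last first.
  by rewrite (inner_door vW vs cW dW).
case/eqP: Wn0; apply/eqP; rewrite eqEcard -ltnS cW outer_door_card leqnn andbT.
apply/subsetP => w wW; have /codomP[q wq] := Ws _ wW; rewrite wq.
apply: imset_f; rewrite -iW; apply/imsetP; exists w => //.
by rewrite wq sK.
Qed.

End Scarf.

Section ScarfSlack.
Variables (I T : finType) (r : I -> T -> nat) (c : T -> I).
Hypothesis r_inj : forall i, injective (r i).

(** The successor reserves [0] for the slack element of [i]. The other slack elements start just
    above every point, and [enum_rank] keeps them apart. *)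
Definition slack_rank (i : I) (v : T + I) : nat :=
  match v with
  | inl t => (r i t).+1
  | inr k => if k == i then 0 else (\max_t r i t).+2 + enum_rank k
  end.

Lemma slack_rank_inj i : injective (slack_rank i).
Proof.
have le t : r i t <= \max_t r i t := leq_bigmax t.
move=> [t|k] [t'|k'] /=.
- by move=> [] /r_inj ->.
- case: eqP => // _ e; have := le t; rewrite -ltnS e.
  by rewrite !addSn !ltnS ltnNge leq_addr.
- case: eqP => // _ e; have := le t'; rewrite -ltnS -e.
  by rewrite !addSn !ltnS ltnNge leq_addr.
- have [->|ki] := eqVneq k i; have [->|k'i] := eqVneq k' i => //.
  by move=> /addnI /ord_inj /enum_rank_inj ->.
Qed.

(** [sigma] consists of the points of a colorful room and [C] of the indices whose slack element is
    absent from it. Only these can witness domination of a point, and their colors must come from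
    points. *)
Lemma scarf (t0 : T) (i0 : I) : exists (sigma : {set T}) (C : {set I}),
  (forall y, exists2 i, i \in C &
    forall x, x \in sigma -> r i y <= r i x) /\
  (forall i, i \in C -> exists2 x, x \in sigma & c x = i).
Proof.
(* [colorful_room] assumes two indices; for a single one, a point of greatest rank suffices. *)
have [I_gt1|I_le1] := ltnP 1 #|I|; last first.
  have I1 i : i = i0 by have /fintype_le1P/(_ i0 i) := I_le1.
  have [x _ xm] := @arg_maxnP T t0 predT (r i0) isT.
  exists [set x], [set: I]; split=> [y|i _].
    by exists i0 => // z /set1P ->; exact: xm.
  by exists x; rewrite ?set11// (I1 i) (I1 (c x)).
pose col (v : T + I) := match v with inl t => c t | inr k => k end.
have smin i v : slack_rank i (inr i) <= slack_rank i v by rewrite /= eqxx.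
have slarge i k v : v \notin codom inr -> k != i ->
    slack_rank i v < slack_rank i (inr k).
  case: v => [t _ ki|j]; last by rewrite codom_f.
  rewrite /= (negPf ki) addSn addSn 2!ltnS.
  by rewrite (leq_trans (leq_bigmax t))// leq_addr.
have inrK : cancel inr col by [].
have t0P : inl t0 \notin codom (inr : I -> T + I) by apply/codomP => -[].
have [Z /dominatingP dZ cZ] :=
  colorful_room slack_rank_inj smin slarge inrK t0P i0 I_gt1.
exists [set t | inl t \in Z], [set i | inr i \notin Z]; split=> [y|i].
  have [i iy] := dZ (inl y); exists i; rewrite ?inE.
    by apply/negP => /iy; rewrite /= eqxx.
  by move=> x; rewrite inE => /iy.
rewrite inE => iZ; have : i \in col @: Z by rewrite cZ inE.
move=> /imsetP[[t tZ it|k kZ ik]]; first by exists t; rewrite ?inE.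
by rewrite ik kZ in iZ.
Qed.

End ScarfSlack.

(* Imported only now, because [classical_sets] shadows names of [finset]. *)
From mathcomp Require Import all_classical all_reals all_analysis.
From mathcomp Require Import zify ring lra.

Import Order.TTheory GRing.Theory Num.Theory.
Import numFieldNormedType.Exports.

Local Open Scope classical_set_scope.
Local Open Scope ring_scope.

(** * Brouwer's theorem on a simplex *)

Section Grid.
Variables (n N : nat).
Local Open Scope nat_scope.

Definition grid := {f : {ffun 'I_n.+1 -> 'I_N.+1} | \sum_i f i == N}.

Definition grid_val (f : grid) (i : 'I_n.+1) : nat := val f i.

Lemma grid_sum f : \sum_i grid_val f i = N.
Proof. exact/eqP/(valP f). Qed.

(** Lexicographic: coordinate [i] first, then [enum_rank] to break ties. *)
Definition grid_rank (i : 'I_n.+1) (f : grid) : nat :=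
  grid_val f i * #|{: grid}| + enum_rank f.

Lemma grid_rank_le i f f' : grid_rank i f <= grid_rank i f' ->
  grid_val f i <= grid_val f' i.
Proof.
apply: contraTT; rewrite -!ltnNge => lt.
rewrite /grid_rank (@leq_trans ((grid_val f' i).+1 * #|{: grid}|))//.
  by rewrite mulSn addnC ltn_add2r.
by rewrite (leq_trans (leq_mul lt (leqnn _)))// leq_addr.
Qed.

Lemma grid_rank_inj i : injective (grid_rank i).
Proof.
move=> f f' e; have ee : grid_val f i = grid_val f' i.
  by apply/eqP; rewrite eqn_leq !grid_rank_le// e.
by move: e; rewrite /grid_rank ee => /addnI /ord_inj /enum_rank_inj.
Qed.

Lemma grid_from (h : 'I_n.+1 -> nat) (i1 : 'I_n.+1) : \sum_i h i <= N ->
  exists f : grid, forall i, h i <= grid_val f i.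
Proof.
move=> hN; pose y i := h i + (i == i1) * (N - \sum_i h i).
have sy : \sum_i y i = N.
  rewrite big_split /= [X in _ + X](bigD1 i1)//= [X in _ + (_ + X)]big1 ?eqxx.
    by rewrite mul1n addn0 subnKC.
  by move=> i /negPf ->.
have yN i : y i < N.+1 by rewrite ltnS -[leqRHS]sy (bigD1 i)//= leq_addr.
have fP : \sum_i ([ffun i => Ordinal (yN i)] : {ffun _ -> 'I_N.+1}) i == N.
  by rewrite -[X in _ == X]sy; apply/eqP/eq_bigr => i _; rewrite ffunE.
exists (exist _ [ffun i => Ordinal (yN i)] fP) => i.
by rewrite /grid_val /= ffunE /= leq_addr.
Qed.

(** [x] is any member of the [sigma] of Scarf's lemma, whose members differ by at most [n.+1] in
    each coordinate. Coordinates outside [C] are small on all of [sigma]. *)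
Lemma grid_room (c : grid -> 'I_n.+1) :
  exists x : grid, forall i,
    (grid_val x i <= n.+1) \/
    exists2 y : grid, c y = i &
      forall j, grid_val x j <= grid_val y j + n.+1 /\
                grid_val y j <= grid_val x j + n.+1.
Proof.
have [t0 _] : exists f : grid, forall i, 0 <= grid_val f i.
  by apply: (@grid_from (fun=> 0) ord0); rewrite big1.
have [sigma [C [dom col]]] := scarf c grid_rank_inj t0 ord0.
have [i1 i1C _] := dom t0.
have [x0 x0s _] := col i1 i1C.
pose m i := grid_val [arg min_(x < x0 in sigma) grid_val x i] i.
have mP i x : x \in sigma -> m i <= grid_val x i.
  by rewrite /m; case: arg_minnP => //= z _; apply.
have mA i : exists2 x, x \in sigma & m i = grid_val x i.
  by rewrite /m; case: arg_minnP => // z zs _; exists z.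
(* Otherwise [grid_from] gives a grid point strictly above the minima of [sigma] in all coordinates
   of [C], against domination. *)
have big : N < \sum_(i in C) (m i).+1.
  rewrite ltnNge; apply/negP => small.
  have [|y yh] := @grid_from (fun i => if i \in C then (m i).+1 else 0) i1.
    by rewrite -big_mkcond.
  have [i iC iy] := dom y; have [x xs mx] := mA i.
  have := leq_trans (yh i) (grid_rank_le (iy x xs)).
  by rewrite iC mx ltnn.
clearbody m.
have {}big : N < \sum_(i in C) m i + n.+1.
  apply: (leq_trans big); under eq_bigr do rewrite -addn1.
  by rewrite big_split /= sum1_card leq_add2l -[leqRHS]card_ord max_card.
(* Coordinates sum to [N], and the minima over [C] fall short of [N] by less than [n.+1], which
   bounds the excess of a coordinate over its minimum. *)
have upC x i : x \in sigma -> i \in C -> grid_val x i <= m i + n.+1.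
  move=> xs iC; have := grid_sum x; rewrite (bigD1 i)//=.
  move: big; rewrite (bigD1 i)//=.
  have : \sum_(j in C | j != i) m j <= \sum_(j | j != i) grid_val x j.
    rewrite [leqRHS](bigID (mem C))/=.
    under [X in _ <= X + _]eq_bigl do rewrite andbC.
    by rewrite (leq_trans _ (leq_addr _ _))// leq_sum// => j _; exact: mP.
  have aux (a b d e k : nat) : a <= b -> N < d + a + k -> e + b = N ->
    e <= d + k by lia.
  exact: aux.
have upNC x i : x \in sigma -> i \notin C -> grid_val x i <= n.+1.
  move=> xs iC; have := grid_sum x; rewrite (bigD1 i)//=.
  move: big; have : \sum_(j in C) m j <= \sum_(j | j != i) grid_val x j.
    rewrite [leqRHS](bigID (mem C))/=.
    rewrite (leq_trans _ (leq_addr _ _))//.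
    rewrite [leqRHS](eq_bigl (mem C)) => [|j].
      by apply: leq_sum => j _; exact: mP.
    rewrite /= andbC; case: (boolP (j \in C)) => //= jC.
    by apply: contraNneq iC => <-.
  have aux (a b e k : nat) : a <= b -> N < a + k -> e + b = N -> e <= k by lia.
  exact: aux.
have close x y j : x \in sigma -> y \in sigma ->
    grid_val x j <= grid_val y j + n.+1.
  move=> xs ys; have [jC|jC] := boolP (j \in C).
    by rewrite (leq_trans (upC x j xs jC))// leq_add2r mP.
  by rewrite (leq_trans (upNC x j xs jC))// leq_addl.
exists x0 => i; have [iC|iC] := boolP (i \in C); last by left; exact: upNC.
have [y ys cy] := col i iC.
by right; exists y => // j; split; exact: close.
Qed.

End Grid.

Lemma within_continuous_normP (R : realType) (V W : normedModType R)
    (A : set V) (f : V -> W) : {within A, continuous f} <->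
  forall x, A x -> forall e, 0 < e ->
    exists2 d, 0 < d & forall y, A y -> `|x - y| < d -> `|f x - f y| < e.
Proof.
rewrite subspace_continuousP; split=> H x Ax.
  move=> e e0; have /cvgrPdist_lt/(_ _ e0) := H x Ax.
  rewrite near_withinE => /nbhs_ballP[d /= d0 dH]; exists d => // y Ay xy.
  by apply: dH => //; rewrite -ball_normE.
apply/cvgrPdist_lt => e e0; rewrite near_withinE.
have [d d0 dH] := H x Ax e e0.
apply/nbhs_ballP; exists d => //= y.
by rewrite -ball_normE /= => xy Ay; exact: dH.
Qed.

Lemma coord_le_norm (R : realType) n (v : 'rV[R]_n) i : `|v 0 i| <= `|v|.
Proof.
rewrite [leRHS]/Num.norm /= mx_normrE.
by rewrite (le_bigmax _ (fun k : 'I_1 * 'I_n => `|v k.1 k.2|) (0, i)).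
Qed.

Section Brouwer.
Variables (R : realType) (n : nat).

Definition simplex : set 'rV[R]_n.+1 :=
  [set v | (forall i, 0 <= v 0 i) /\ \sum_i v 0 i = 1].

Lemma simplex_le1 v i : simplex v -> v 0 i <= 1.
Proof.
by move=> [v0 <-]; rewrite (bigD1 i)//= lerDl sumr_ge0.
Qed.

Lemma simplex_compact : compact simplex.
Proof.
apply: bounded_closed_compact.
  exists 1; split => // M M1 v sv /=.
  rewrite (le_trans _ (ltW M1))// [`|v|]mx_normrE.
  apply: bigmax_le => // -[i j] _ /=; rewrite (ord1 i).
  have [v0 _] := sv.
  by rewrite ger0_norm ?simplex_le1.
have -> : simplex = \bigcap_i [set v : 'rV[R]_n.+1 | 0 <= v 0 i] `&`
    [set v : 'rV[R]_n.+1 | \sum_i v 0 i = 1].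
  apply/seteqP; split=> v [v0 v1]; split=> // i; last exact: v0.
  by move=> _; exact: v0.
apply: closedI.
  apply: closed_bigI => i _.
  apply: (@preimage_closed _ _ (fun v : 'rV[R]_n.+1 => v 0 i) [set x | 0 <= x]).
    by move=> v _; exact: coord_continuous.
  exact: closed_ge.
apply: (@preimage_closed _ _ (fun v : 'rV[R]_n.+1 => \sum_i v 0 i) [set 1]).
  move=> v _; apply: continuous_big => [|i _]; first exact: add_continuous.
  exact: coord_continuous.
exact: closed_eq.
Qed.

(** A grid point is colored by a coordinate that [g] does not decrease; one exists because both sums
    of coordinates are [1]. If coordinate [i] of [x] is itself small, [y = x] serves. *)
Lemma brouwer_grid (g : 'rV[R]_n.+1 -> 'rV[R]_n.+1) (N : nat) :
  set_fun simplex simplex g -> exists2 x, simplex x &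
    forall i, exists y, [/\ simplex y, `|x - y| <= n.+1%:R / N.+1%:R &
      y 0 i <= g y 0 i + n.+1%:R / N.+1%:R].
Proof.
move=> gS; pose pt (f : grid n N.+1) : 'rV[R]_n.+1 :=
  \row_i ((grid_val f i)%:R / N.+1%:R).
have N0 : 0 < N.+1%:R :> R by rewrite ltr0n.
have ptS f : simplex (pt f).
  split=> [i|]; first by rewrite mxE divr_ge0 ?ler0n.
  under eq_bigr do rewrite mxE.
  by rewrite -mulr_suml -natr_sum grid_sum divff ?gt_eqF.
pose c f := odflt 0 [pick i | pt f 0 i <= g (pt f) 0 i].
have cP f : pt f 0 (c f) <= g (pt f) 0 (c f).
  rewrite /c; case: pickP => //= none; exfalso.
  have [_ s1] := ptS f; have [_ s2] := gS _ (ptS f).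
  suff : \sum_i g (pt f) 0 i < \sum_i pt f 0 i by rewrite s1 s2 ltxx.
  apply: ltr_sum => [|i _].
    by apply/hasP; exists ord0; rewrite ?mem_index_enum.
  by have := none i; rewrite leNgt => /negbFE.
have [x xP] := grid_room c; exists (pt x) => // i.
have [xi|[y cy xy]] := xP i.
  exists (pt x); rewrite subrr normr0 divr_ge0 ?ler0n//; split=> //.
  have [g0 _] := gS _ (ptS x).
  rewrite mxE -[leLHS]add0r lerD// ler_pM2r ?invr_gt0// ler_nat.
  exact: xi.
exists (pt y); split => //; last first.
  by rewrite -cy (le_trans (cP y))// lerDl divr_ge0 ?ler0n.
rewrite [leLHS]/Num.norm /= mx_normrE; apply: bigmax_le => [|[j k] _] /=.
  by rewrite divr_ge0 ?ler0n.
rewrite !mxE -mulrBl normrM [`|_^-1|]gtr0_norm ?invr_gt0// ler_pM2r ?invr_gt0//.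
have [] := xy k; rewrite -!(ler_nat R) !natrD ler_norml; lra.
Qed.

(** At a cluster point of the approximate solutions, [g] decreases no coordinate; as the coordinates
    of [x] and [g x] have the same sum, they agree. *)
Lemma brouwer_simplex (g : 'rV[R]_n.+1 -> 'rV[R]_n.+1) :
  set_fun simplex simplex g -> {within simplex, continuous g} ->
  exists2 x, simplex x & g x = x.
Proof.
move=> gS /within_continuous_normP gc.
have /choice[x_ x_P] : forall N, exists x, simplex x /\
    forall i, exists y, [/\ simplex y, `|x - y| <= n.+1%:R / N.+1%:R &
      y 0 i <= g y 0 i + n.+1%:R / N.+1%:R].
  by move=> N; have [x] := brouwer_grid N gS; exists x.
have [|x [xS xcl]] := simplex_compact (fmap_proper_filter x_ eventually_filter).
  by exists 0%N => // N _ /=; case: (x_P N).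
have xg i : x 0 i <= g x 0 i.
  (* The gap is [4 * e], while the errors on [x], on [g x] and in the grid inequality add up to less
     than [3 * e]. *)
  rewrite leNgt; apply/negP => gx; pose e := (x 0 i - g x 0 i) / 4.
  have e0 : 0 < e by rewrite divr_gt0// subr_gt0.
  have [d d0 dP] := gc x xS e e0.
  pose m := Num.min d e; have m0 : 0 < m by rewrite lt_min d0.
  have [N0 N0P] : exists N0, forall N, (N0 <= N)%N -> n.+1%:R / N.+1%:R < m / 2.
    have e'0 : 0 < m / 2 / n.+1%:R by rewrite !divr_gt0.
    have [N0 _ N0P] := near_infty_natSinv_lt (PosNum e'0).
    by exists N0 => N /N0P /=; rewrite ltr_pdivlMr// mulrC.
  have [_ [[N N0N <-]]] :
      (x_ @` [set N | (N0 <= N)%N]) `&` ball x (m / 2) !=set0.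
    apply: xcl; last by apply: nbhsx_ballx; rewrite divr_gt0.
    by exists N0 => // N N0N; exists N.
  rewrite -ball_normE /= => xN; have [_ /(_ i)[y [yS xy yg]]] := x_P N.
  have Nm := N0P _ N0N.
  have xym : `|x - y| < m.
    rewrite (splitr m) (le_lt_trans (ler_distD (x_ N) _ _))// ltrD//.
    exact: le_lt_trans xy Nm.
  have [xyd xye] : `|x - y| < d /\ `|x - y| < e.
    by move: xym; rewrite lt_min => /andP.
  have := coord_le_norm (x - y) i; rewrite !mxE.
  have := coord_le_norm (g x - g y) i; rewrite !mxE.
  have := dP y yS xyd.
  have : m <= e by rewrite ge_min lexx orbT.
  have aux (a b p q nx ng k : R) : k < m / 2 -> p <= q + k -> nx < e ->
      e = (a - b) / 4 -> m <= e -> ng < e -> - ng <= b - q <= ng ->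
      - nx <= a - p <= nx -> False.
    by move: e0; clearbody m e; lra.
  rewrite !ler_norml; exact: (aux _ _ _ _ _ _ _ Nm yg xye erefl).
exists x => //; apply/rowP => i; apply/eqP; rewrite eq_le xg andbT leNgt.
apply/negP => lt; have [_ s1] := xS; have [_ s2] := gS _ xS.
suff : \sum_i x 0 i < \sum_i g x 0 i by rewrite s1 s2 ltxx.
rewrite (bigD1 i)//= [ltRHS](bigD1 i)//= ltr_leD// ler_sum//.
Qed.

End Brouwer.

Arguments simplex {R n}.

(** * Weak approximate fixed points along an ultrafilter *)

Lemma convex_sum (R : realType) (X : lmodType R) (C : set X) n
    (w : 'I_n.+1 -> R) (y : 'I_n.+1 -> X) :
  convex_set C -> (forall j, C (y j)) -> (forall j, 0 <= w j) ->
  \sum_j w j = 1 -> C (\sum_j w j *: y j).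
Proof.
move=> cC; have conv2 x z t : C x -> C z -> 0 <= t <= 1 ->
    C (t *: x + (1 - t) *: z).
  move=> Cx Cz t01; have := cC x z (Itv01 (andP t01).1 (andP t01).2).
  by rewrite !inE; apply.
elim: n w y => [|n IH] w y Cy w0.
  by rewrite !big_ord1 => ->; rewrite scale1r.
rewrite big_ord_recl [X in _ -> C X]big_ord_recl; set s := \sum_i _ => ws.
have s0 : 0 <= s by rewrite sumr_ge0.
have sE : s = 1 - w ord0 by apply/eqP; rewrite eq_sym subr_eq addrC ws.
have [s00|sN0] := eqVneq s 0.
  rewrite big1 ?addr0.
    have -> : w ord0 = 1 by rewrite -[w ord0]addr0 -{1}s00.
    by rewrite scale1r.
  move=> i _; have /eqP := s00; rewrite psumr_eq0// => /allP/(_ i).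
  by rewrite mem_index_enum => /(_ isT) /= /eqP ->; rewrite scale0r.
have -> : \sum_(i < n.+1) w (lift ord0 i) *: y (lift ord0 i) =
    (1 - w ord0) *: \sum_(i < n.+1) (w (lift ord0 i) / s) *: y (lift ord0 i).
  rewrite -sE scaler_sumr; apply: eq_bigr => i _.
  by rewrite scalerA mulrCA divff// mulr1.
apply: conv2 => //; last by rewrite w0 /= -ws lerDl.
apply: IH => // [j|]; first by rewrite divr_ge0.
by rewrite -mulr_suml divff.
Qed.

Lemma cvg_rV (R : realType) (T : Type) (F : set_system T) (FF : Filter F) n
    (u : T -> 'rV[R]_n) (l : 'rV[R]_n) :
  (forall i, u t 0 i @[t --> F] --> l 0 i) -> u t @[t --> F] --> l.
Proof.
move=> ul; apply/cvgrPdist_lt => e e0.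
have : \forall t \near F, forall i, `|l 0 i - u t 0 i| < e.
  by apply: filter_forall => i; have /cvgrPdist_lt := ul i; apply.
apply: filterS => t tP; rewrite /Num.norm /= mx_normrE.
by apply: bigmax_lt => // -[i j] _; rewrite /= (ord1 i) !mxE.
Qed.

(** * Approximate fixed points for a continuous seminorm *)

Section SeminormFixedPoints.
Variables (R : realType) (X : normedModType R) (C : set X) (f : X -> X).
Variable rho : X -> R.
Hypothesis C_convex : convex_set C.
Hypothesis fC : set_fun C C f.
Hypothesis f_cont : {within C, continuous f}.
Hypothesis rhoD : forall a b, rho (a + b) <= rho a + rho b.
Hypothesis rhoZ : forall k a, rho (k *: a) = `|k| * rho a.
Hypothesis rho_cont : continuous rho.

Let rho_sum n (w : 'I_n.+1 -> R) (a : 'I_n.+1 -> X) :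
  rho (\sum_j w j *: a j) <= \sum_j `|w j| * rho (a j).
Proof.
elim/big_ind2 : _ => // [|a1 b1 a2 b2 h1 h2|j _]; last by rewrite rhoZ.
  by have := rhoZ 0 0; rewrite scale0r normr0 mul0r => ->.
exact: le_trans (rhoD _ _) (lerD h1 h2).
Qed.

(** Schauder projection: [f] followed by a partition of unity subordinate to the net acts on the
    simplex of coefficients. Its Brouwer fixed point [l] has weight only on net points within [e] of
    [f (p l)]. *)
Lemma seminorm_fixpt n (y : 'I_n.+1 -> X) e : 0 < e -> (forall j, C (y j)) ->
  (forall x, C x -> exists j, rho (x - y j) < e) ->
  exists2 x, C x & rho (x - f x) <= e.
Proof.
move=> e0 Cy net.
(* Twice the positive part of [e - rho (x - y j)]. *)
pose v j x := (e - rho (x - y j)) + `|e - rho (x - y j)|.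
have v0 j x : 0 <= v j x by rewrite /v -lerBlDl sub0r -normrN ler_norm.
have v_gt0 j x : rho (x - y j) < e -> 0 < v j x.
  by move=> lt; rewrite /v ltr_pwDl// subr_gt0.
have v_neq0 j x : v j x != 0 -> rho (x - y j) <= e.
  apply: contraNT; rewrite -ltNge -subr_lt0 => lt.
  by rewrite /v ltr0_norm// subrr.
pose V x := \sum_j v j x.
have V_gt0 x : C x -> 0 < V x.
  move=> /net[j jx]; rewrite /V (bigD1 j)//= ltr_pwDl//; first exact: v_gt0.
  by rewrite sumr_ge0.
pose p (l : 'rV[R]_n.+1) := \sum_j l 0 j *: y j.
have pC l : simplex l -> C (p l) by move=> [l0 l1]; exact: convex_sum.
have p_cont : continuous p.
  apply: continuous_big => [|j _]; first exact: add_continuous.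
  by move=> l; apply: continuousZr_tmp; exact: coord_continuous.
pose g (l : 'rV[R]_n.+1) : 'rV[R]_n.+1 := \row_j (v j (f (p l)) / V (f (p l))).
have gS : set_fun simplex simplex g.
  move=> l lS; have fl := V_gt0 _ (fC (pC _ lS)).
  split=> [j|]; first by rewrite mxE divr_ge0// ltW.
  by under eq_bigr do rewrite mxE; rewrite -mulr_suml divff// gt_eqF.
have g_cont : {within simplex, continuous g}.
  apply/subspace_continuousP => l lS; set F := within _ _.
  have fp : f (p m) @[m --> F] --> f (p l).
    apply: (@cvg_comp _ _ _ p f F (within C (nbhs (p l)))).
      move=> A Ap; have mA : \forall m \near l, C (p m) -> A (p m).
        exact: (p_cont l _ Ap).
      apply: (@filterS _ (nbhs l) _ _ _ _ mA) => m + mS; apply; exact: pC.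
    by move/subspace_continuousP : f_cont; apply; exact: pC.
  have vl j : v j (f (p m)) @[m --> F] --> v j (f (p l)).
    have rl : e - rho (f (p m) - y j) @[m --> F] --> e - rho (f (p l) - y j).
      apply: (@cvgB _ _ _ F _ (fun=> e)); first exact: cvg_cst.
      apply: (@continuous_cvg _ _ _ F _ (fun m => f (p m) - y j) rho _).
        exact: rho_cont.
      by apply: cvgB => //; exact: cvg_cst.
    by apply: cvgD => //; exact: cvg_norm.
  apply: cvg_rV => j; rewrite mxE; under eq_cvg do rewrite mxE.
  apply: cvgM => //; apply: cvgV.
    by rewrite gt_eqF// V_gt0//; exact/fC/pC.
  by apply: cvg_big => [|k _]; [exact: add_continuous|exact: vl].
have [l lS gl] := brouwer_simplex gS g_cont.
exists (p l); first exact: pC.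
have fl := V_gt0 _ (fC (pC _ lS)).
have [l0 l1] := lS.
have -> : p l - f (p l) = \sum_j l 0 j *: (y j - f (p l)).
  under eq_bigr do rewrite scalerBr.
  by rewrite sumrB -scaler_suml l1 scale1r.
rewrite (le_trans (rho_sum _ _))// -[leRHS]mul1r -l1 mulr_suml.
apply: ler_sum => j _; rewrite ger0_norm//.
have [->|lj] := eqVneq (l 0 j) 0; first by rewrite !mul0r.
rewrite ler_wpM2l// -opprB -scaleN1r rhoZ normrN1 mul1r v_neq0//.
apply: contraNneq lj; rewrite -gl mxE => vj.
by rewrite gl /v in vj *; rewrite vj mul0r.
Qed.

End SeminormFixedPoints.

(** * The dual unit ball *)

Section DualBall.
Variables (R : realType) (X : normedModType R).

(** Linearity is a property of plain functions, so that pointwise limits along an ultrafilter stay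
    in the same type. *)
Definition dual_ball : set (X -> R) :=
  [set phi | (forall a x y, phi (a *: x + y) = a * phi x + phi y) /\
             forall x, `|phi x| <= `|x|].

Lemma dual_ballB phi x y : dual_ball phi -> phi (x - y) = phi x - phi y.
Proof.
by move=> [lin _]; rewrite addrC -scaleN1r lin mulN1r addrC.
Qed.

Lemma dual_ballD phi x y : dual_ball phi -> phi (x + y) = phi x + phi y.
Proof. by move=> [lin _]; rewrite -[x]scale1r lin mul1r scale1r. Qed.

Lemma dual_ball0 phi : dual_ball phi -> phi 0 = 0.
Proof. by move=> h; rewrite -(subrr 0) dual_ballB// subrr. Qed.

Lemma dual_ballZ phi a x : dual_ball phi -> phi (a *: x) = a * phi x.
Proof.
move=> h; rewrite -[a *: x]addr0; case: (h) => -> _.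
by rewrite dual_ball0// addr0.
Qed.

Lemma dual_ball_opp phi : dual_ball phi -> dual_ball (fun x => - phi x).
Proof.
move=> [lin bd]; split=> [a x y|x]; last by rewrite normrN.
by rewrite lin opprD mulrN.
Qed.

(** The bounded range of each [phi i] is cut into finitely many cells of width [d], and a point of
    [C] is picked for each combination of cells that occurs. *)
Lemma finite_dual_net (C : set X) k (phi : 'I_k -> X -> R) e :
  0 < e -> C !=set0 -> bounded_set C -> (forall i, dual_ball (phi i)) ->
  exists n (y : 'I_n.+1 -> X), (forall j, C (y j)) /\
    forall x, C x -> exists j, \sum_i `|phi i (x - y j)| < e.
Proof.
move=> e0 [x0 Cx0] /pinfty_ex_gt0[B B0 CB] phiP.
(* With [k.+1] rather than [k], the sum of [k] errors is strictly below [e], also for [k = 0]. *)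
pose d := e / k.+1%:R; have d0 : 0 < d by rewrite divr_gt0.
pose q i x := Num.truncn ((phi i x + B) / d).
have qP i x : C x -> (q i x)%:R * d <= phi i x + B < (q i x).+1%:R * d.
  move=> Cx; have := CB x Cx; have [_ /(_ x) h] := phiP i.
  move=> /(le_trans h); rewrite ler_norml => /andP[h1 _].
  rewrite -ler_pdivlMr// -ltr_pdivrMr//; apply: truncn_itv.
  by rewrite divr_ge0 ?(ltW d0)// -lerBlDr sub0r.
pose M := Num.truncn ((B + B) / d).
have qM i x : C x -> (q i x < M.+1)%N.
  move=> Cx; have := CB x Cx; have [_ /(_ x) h] := phiP i.
  move=> /(le_trans h); rewrite ler_norml => /andP[_ h1].
  by rewrite ltnS le_truncn// ler_pM2r ?invr_gt0// lerD2r.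
pose J : finType := {ffun 'I_k -> 'I_M.+1}.
pose cell x : J := [ffun i => inord (q i x)].
have /choice[Y YP] : forall c : J, exists y, C y /\
    forall x, C x -> cell x = c -> cell y = c.
  move=> c; have [[y [Cy yc]]|none] := pselect (exists y, C y /\ cell y = c).
    by exists y.
  exists x0; split => // x Cx xc; exfalso; apply: none; by exists x.
(* The extra index [ord_max] carries [x0] and gives the index type the form ['I_n.+1]. *)
exists #|{: J}|, (fun j =>
  if unlift ord_max j is Some j' then Y (enum_val j') else x0).
split=> [j|x Cx]; first by case: unlift => [j'|//]; case: (YP (enum_val j')).
exists (lift ord_max (enum_rank (cell x))); rewrite liftK enum_rankK.
have [CY /(_ x Cx erefl) Yx] := YP (cell x).
have lt i : `|phi i (x - Y (cell x))| <= d.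
  have qq : q i (Y (cell x)) = q i x.
    have /(congr1 (@nat_of_ord _)) := congr1 (fun h : J => h i) Yx.
    by rewrite !ffunE !inordK// qM.
  have /andP[a1 a2] := qP i x Cx; have := qP i _ CY.
  rewrite qq => /andP[b1 b2]; rewrite (dual_ballB _ _ (phiP i)).
  move: a1 a2 b1 b2; rewrite -addn1 natrD mulrDl mul1r ler_norml; lra.
rewrite (@le_lt_trans _ _ (\sum_(i < k) d))//; first exact: ler_sum.
rewrite sumr_const card_ord -mulr_natl /d mulrCA gtr_pMr//.
by rewrite ltr_pdivrMr// mul1r ltr_nat.
Qed.

Lemma dual_ball_continuous phi : dual_ball phi -> continuous phi.
Proof.
move=> h x; apply/cvgrPdist_lt => e e0.
have : \forall y \near x, `|x - y| < e by exact: cvgr_dist_lt.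
apply: filterS => y xy; rewrite -(dual_ballB _ _ h); case: (h) => _ bd.
exact: le_lt_trans (bd _) xy.
Qed.

Lemma barroso_lin (C : set X) (f : X -> X) k (phi : 'I_k -> X -> R) e :
  C !=set0 -> convex_set C -> bounded_set C ->
  set_fun C C f -> {within C, continuous f} ->
  (forall i, dual_ball (phi i)) -> 0 < e ->
  exists2 x, C x & forall i, `|phi i (x - f x)| <= e.
Proof.
move=> C0 cC bC fC fc phiP e0.
have [n [y [Cy net]]] := finite_dual_net e0 C0 bC phiP.
pose rho x := \sum_i `|phi i x|.
have rhoD a b : rho (a + b) <= rho a + rho b.
  rewrite -big_split; apply: ler_sum => i _.
  by rewrite (dual_ballD _ _ (phiP i)) ler_normD.
have rhoZ l a : rho (l *: a) = `|l| * rho a.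
  rewrite mulr_sumr; apply: eq_bigr => i _.
  by rewrite (dual_ballZ _ _ (phiP i)) normrM.
have rho_cont : continuous rho.
  apply: continuous_big => [|i _]; first exact: add_continuous.
  move=> x; apply: cvg_norm; exact: dual_ball_continuous.
have [x Cx le] := seminorm_fixpt cC fC fc rhoD rhoZ rho_cont e0 Cy net.
exists x => // i; rewrite (le_trans _ le)// /rho (bigD1 i)//= lerDl.
by rewrite sumr_ge0.
Qed.

End DualBall.

Lemma ultra_bounded_cvg (R : realType) (T : Type) (G : set_system T)
    (u : T -> R) (B : R) : UltraFilter G -> (\forall t \near G, `|u t| <= B) ->
  exists2 l, `|l| <= B & u t @[t --> G] --> l.
Proof.
move=> GU uB; have GF : ProperFilter G := @ultra_proper _ _ GU.
have [|l [lB lcl]] := @segment_compact R (- B) B _ (fmap_proper_filter u GF).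
  by apply: filterS uB => t /=; rewrite ler_norml in_itv.
exists l; first by move: lB; rewrite /= in_itv ler_norml.
apply/cvgrPdist_lt => e e0.
have [//|nA] := in_ultra_setVsetC [set t | `|l - u t| < e] GU.
have [||z []] := lcl [set z | ~ `|l - z| < e] (ball l e).
- exact: nA.
- exact: nbhsx_ballx.
by rewrite -ball_normE.
Qed.

(** Compactness of a power of the dual ball. If no finite list works, the sets [bad L] generate a
    proper filter. An ultrafilter above it has a pointwise limit [psi], and the [x] that serves
    [psi] serves almost all [phi], against [bad [:: x]]. *)
Lemma dual_ball_finite_subfamily (R : realType) (X : normedModType R)
    (D : set X) (z : X -> X) k (e : R) : 0 < e ->
  (forall phi : 'I_k -> X -> R, (forall j, dual_ball (phi j)) ->
     exists2 x, D x & forall j, `|phi j (z x)| < e) ->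
  exists L : seq X, (forall x, x \in L -> D x) /\
    forall phi : 'I_k -> X -> R, (forall j, dual_ball (phi j)) ->
      exists2 x, x \in L & forall j, `|phi j (z x)| < e.
Proof.
move=> e0 H; apply: contrapT => nL.
pose bad (L : seq X) := [set phi : 'I_k -> X -> R |
  (forall j, dual_ball (phi j)) /\
  forall x, x \in L -> exists j, e <= `|phi j (z x)|].
pose DL := [set L : seq X | forall x, x \in L -> D x].
have bad_ex L : DL L -> bad L !=set0.
  move=> LD; apply: contrapT => nb; apply: nL; exists L; split => // phi phiP.
  apply: contrapT => nx; apply: nb; exists phi; split => // x xL.
  apply: contrapT => nj; apply: nx; exists x => // j.
  by rewrite ltNge; apply/negP => le; apply: nj; exists j.
have FF : ProperFilter (filter_from DL bad).
  apply: filter_from_proper => //; apply: filter_from_filter.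
    by exists [::].
  move=> L1 L2 D1 D2; exists (L1 ++ L2).
    by move=> x; rewrite mem_cat => /orP[/D1|/D2].
  move=> phi [phiP phib]; split; split => // x xL; apply: phib;
    by rewrite mem_cat xL ?orbT.
have [G [GU FG]] := ultraFilterLemma FF.
have GF : ProperFilter G := @ultra_proper _ _ GU.
have Gdual : \forall phi \near G, forall j, dual_ball (phi j).
  by apply: FG; exists [::] => // phi [].
have /choice[psi' psiP'] : forall jx : 'I_k * X, exists l : R,
    `|l| <= `|jx.2| /\ phi jx.1 jx.2 @[phi --> G] --> l.
  move=> [j x] /=; have [|l lx lG] := @ultra_bounded_cvg R _ G
    (fun phi : 'I_k -> X -> R => phi j x) `|x| GU; last by exists l.
  by apply: filterS Gdual => phi /(_ j)[_]; apply.
pose psi j x := psi' (j, x).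
have psi_cvg j x : phi j x @[phi --> G] --> psi j x by case: (psiP' (j, x)).
have [|x Dx xe] := H psi.
  move=> j; split=> [a x y|x]; last by case: (psiP' (j, x)).
  apply: (cvg_unique (@Rhausdorff R) (psi_cvg j (a *: x + y))).
  have : a * phi j x + phi j y @[phi --> G] --> a * psi j x + psi j y.
    by apply: cvgD => //; apply: cvgM => //; exact: cvg_cst.
  apply: cvg_trans; apply: near_eq_cvg.
  by apply: filterS Gdual => phi /(_ j)[lin _]; rewrite lin.
have Gsmall : \forall phi \near G, forall j, `|phi j (z x)| < e.
  apply: filter_forall => j.
  have : `|phi j (z x)| @[phi --> G] --> `|psi j (z x)| by exact: cvg_norm.
  by move/cvgr_lt; apply.
have Gbad : G (bad [:: x]).
  by apply: FG; exists [:: x] => // y; rewrite inE => /eqP ->.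
have [phi [phie [_ /(_ x)]]] := filter_ex (filterI Gsmall Gbad).
by rewrite mem_head => /(_ isT)[j]; rewrite leNgt phie.
Qed.

(** * Weakly null sequences along an ultrafilter *)

Section WeakNullUltrafilter.
Variables (R : realType) (X : normedModType R) (C : set X) (z : X -> X).
Hypothesis C_weak0 : forall k (phi : 'I_k -> X -> R) e, 0 < e ->
  (forall j, dual_ball (phi j)) ->
  exists2 x, C x & forall j, `|phi j (z x)| < e.

(** The finite lists obtained for all [k] form a countable family, enumerated so that each entry
    recurs infinitely often. *)
Lemma weak_null_enumeration : exists x : nat -> X, (forall n, C (x n)) /\
  forall k (phi : 'I_k -> X -> R) N, (forall j, dual_ball (phi j)) ->
    exists2 n, (N <= n)%N & forall j, `|phi j (z (x n))| < k.+1%:R^-1.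
Proof.
have k0 k : 0 < k.+1%:R^-1 :> R by rewrite invr_gt0.
have [x0 Cx0 _] : exists2 x, C x & forall j : 'I_0, `|0 : R| < 1.
  have [|x Cx _] := @C_weak0 0 (fun _ _ => 0) 1 ltr01; first by case.
  by exists x => // -[].
have /choice[L LP] : forall k, exists L : seq X, (forall x, x \in L -> C x) /\
    forall phi : 'I_k -> X -> R, (forall j, dual_ball (phi j)) ->
      exists2 x, x \in L & forall j, `|phi j (z x)| < k.+1%:R^-1.
  move=> k; apply: dual_ball_finite_subfamily => // phi phiP.
  exact: C_weak0.
pose en n := if (unpickle n : option (nat * nat)) is Some (k, i)
  then nth x0 (L k) i else x0.
have enC n : C (en n).
  rewrite /en; case: unpickle => // -[k i]; have [LC _] := LP k.
  by have [/(mem_nth x0)/LC//|/(nth_default x0) ->] := ltnP i (size (L k)).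
exists (fun n => en (logn 2 n.+1)); split => // k phi N phiP.
have [_ /(_ phi phiP)[x xL xe]] := LP k.
set c := pickle (k, index x (L k)).
have en_c : en c = x by rewrite /en pickleK nth_index.
(* The successor of this index has 2-adic valuation [c], and its odd factor pushes the index beyond
   [N]. *)
exists (2 ^ c * N.*2.+1).-1%N.
  rewrite -ltnS prednK ?muln_gt0 ?expn_gt0//.
  rewrite (leq_trans _ (leq_pmull _ _)) ?expn_gt0// ltnS -addnn leq_addr//.
rewrite prednK ?muln_gt0 ?expn_gt0// lognM ?expn_gt0// pfactorK//.
by rewrite lognE /= dvdn2 /= odd_double /= addn0 en_c.
Qed.

(** Precision improves with the size of a family, so concatenating two families refines both and the
    sets [B p] generate a filter. *)
Lemma weak_null_ultrafilter : exists (x : nat -> X) (U : set_system nat),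
  [/\ forall n, C (x n), UltraFilter U, forall N, U [set n | (N <= n)%N] &
    forall phi, dual_ball phi -> forall e, 0 < e ->
      U [set n | `|phi (z (x n))| < e]].
Proof.
have [x [xC xP]] := weak_null_enumeration.
pose fam k (phi : 'I_k -> X -> R) : {k : nat & 'I_k -> X -> R} :=
  existT _ k phi.
pose D := [set p : nat * {k : nat & 'I_k -> X -> R} |
  forall j, dual_ball (tagged p.2 j)].
pose B (p : nat * {k : nat & 'I_k -> X -> R}) := [set n | (p.1 <= n)%N /\
  forall j, `|tagged p.2 j (z (x n))| < (tag p.2).+1%:R^-1].
have FF : ProperFilter (filter_from D B).
  apply: filter_from_proper => [|[N [k phi]] phiP]; last first.
    by have [n Nn ne] := xP k phi N phiP; exists n.
  apply: filter_from_filter.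
    exists (0%N, @fam 0%N (fun _ _ => 0)) => -[] //.
  move=> [N1 [k1 phi1]] [N2 [k2 phi2]] D1 D2.
  exists (maxn N1 N2, @fam (k1 + k2)%N (fun j =>
    match fintype.split j with
    | inl j1 => phi1 j1
    | inr j2 => phi2 j2
    end)) => /=.
    by move=> j /=; case: fintype.split => j'; [exact: D1|exact: D2].
  move=> n [] /=; rewrite geq_max => /andP[n1 n2] ne.
  split; split => //= j.
    have := ne (lshift k2 j); rewrite -[lshift k2 j]/(unsplit (inl j)) unsplitK.
    move=> /lt_le_trans; apply.
    by rewrite lef_pV2 ?posrE ?ltr0n// ler_nat ltnS leq_addr.
  have := ne (rshift k1 j); rewrite -[rshift k1 j]/(unsplit (inr j)) unsplitK.
  move=> /lt_le_trans; apply.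
  by rewrite lef_pV2 ?posrE ?ltr0n// ler_nat ltnS leq_addl.
have [U [UU FU]] := ultraFilterLemma FF.
have UF : ProperFilter U := @ultra_proper _ _ UU.
exists x, U; split => // [N|phi phiP e e0].
  apply: FU; exists (N, @fam 0%N (fun _ _ => 0)); first by case.
  by move=> n [].
have [k _ /(_ _ (leqnn _))/= ke] := near_infty_natSinv_lt (PosNum e0).
(* Repeating [phi] enlarges the family and thereby reaches the required precision. *)
apply: FU; exists (0%N, @fam k.+1 (fun _ => phi)) => // n [_ /(_ ord0)/=].
move=> /lt_trans; apply; apply: le_lt_trans ke.
by rewrite lef_pV2 ?posrE ?ltr0n// ler_nat.
Qed.

End WeakNullUltrafilter.

(** * Ramsey theory along an ultrafilter *)

Lemma mkseq_cons (T : Type) (m : nat -> T) k :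
  mkseq m k.+1 = m 0%N :: mkseq (fun i => m i.+1) k.
Proof. by rewrite /mkseq /= (iotaDl 1 0) -map_comp. Qed.

(* When [S] is decreasing, subsequences of chains are chains. *)
Definition uchain (S : nat -> set nat) : rel nat := fun a b => b \in S a.

Lemma path_ltn_le_last x t :
  path ltn x t -> all (fun a => (a < (last x t).+1)%N) t.
Proof.
elim/last_ind: t => // t a IH; rewrite rcons_path last_rcons all_rcons leqnn /=.
move=> /andP[/IH {}IH xa]; apply: sub_all IH => b; rewrite !ltnS => bl.
exact: leq_trans bl (ltnW xa).
Qed.

Lemma path_mkseq (S : nat -> set nat) m :
  S 0%N (m 0%N) -> (forall i, S (m i) (m i.+1)) ->
  forall k, path (uchain S) 0%N (mkseq m k).
Proof.
move=> m0 mS; elim=> // k IH; rewrite mkseqS rcons_path IH /uchain inE /=.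
by case: k {IH} => // k; rewrite mkseqS last_rcons.
Qed.

Section UltraTree.
Variables (U : set_system nat) (Q : seq nat -> Prop).
Hypothesis U_ultra : UltraFilter U.
Hypothesis U_tail : forall N, U [set n | (N <= n)%N].

#[local] Instance U_filter : ProperFilter U := @ultra_proper _ _ U_ultra.

(** [T] encodes a tree by its branching sets; every infinite branch extending [s] leaves [Q]. *)
Definition forces_out (s : seq nat) := exists2 T : seq nat -> set nat,
  forall t, U (T t) &
  forall m, (forall i, T (s ++ mkseq m i) (m i)) ->
    exists k, ~ Q (s ++ mkseq m k).

(** The trees of the successors of [s] are glued: above [s], the entry at position [size s] tells
    which one to follow. *)
Lemma forces_out_rcons s : U [set n | forces_out (rcons s n)] -> forces_out s.
Proof.
move=> Us; have /choice[T TP] : forall n, exists T : seq nat -> set nat,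
    (forall t, U (T t)) /\ (forces_out (rcons s n) ->
    forall m, (forall i, T (rcons s n ++ mkseq m i) (m i)) ->
      exists k, ~ Q (rcons s n ++ mkseq m k)).
  move=> n; have [[T TU TP]|nf] := pselect (forces_out (rcons s n)).
    by exists T.
  by exists (fun=> setT); split=> // t; exact: filterT.
pose T' t := if size t == size s then [set n | forces_out (rcons s n)]
             else T (nth 0%N t (size s)) t.
exists T' => [t|m mP].
  by rewrite /T'; case: eqP => // _; case: (TP (nth 0%N t (size s))).
have m0 : forces_out (rcons s (m 0%N)).
  by have := mP 0%N; rewrite cats0 /T' eqxx.
have [_ /(_ m0 (fun i => m i.+1))[i|k Qk]] := TP (m 0%N).
  have := mP i.+1; rewrite mkseq_cons -cat_rcons /T' !size_cat size_rcons.
  rewrite -[X in _ == X]addn0 addSnnS eqn_add2l /= nth_cat size_rcons leqnn.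
  by rewrite nth_rcons ltnn eqxx.
by exists k.+1; rewrite mkseq_cons -cat_rcons.
Qed.

(** If the empty list does not force out, keep the successors that do not either. They form a set in
    [U] because [U] is an ultrafilter, and all nodes reached satisfy [Q], since a node outside [Q]
    forces out trivially. *)
Lemma ultra_tree : exists2 T : seq nat -> set nat, forall t, U (T t) &
  (forall s, (forall i, (i < size s)%N -> T (take i s) (nth 0%N s i)) -> Q s) \/
  (forall m, (forall i, T (mkseq m i) (m i)) -> exists k, ~ Q (mkseq m k)).
Proof.
have [[T TU TP]|nf0] := pselect (forces_out [::]).
  by exists T => //; right.
exists (fun s => [set n | ~ forces_out s -> ~ forces_out (rcons s n)]) => [s|].
  have [fs|nfs] := pselect (forces_out s).
    by apply: filterS filterT => n _ /(_ fs).
  have [/forces_out_rcons//|] :=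
    in_ultra_setVsetC [set n | forces_out (rcons s n)] U_ultra.
  by apply: filterS => n nf _.
left=> s; suff : forall k, (k <= size s)%N ->
    (forall i, (i < size s)%N -> ~ forces_out (take i s) ->
       ~ forces_out (rcons (take i s) (nth 0%N s i))) ->
    ~ forces_out (take k s).
  move=> /(_ _ (leqnn _)) + sP => /(_ sP); rewrite take_size => nfs.
  apply: contrapT => nQ; apply: nfs; exists (fun=> setT) => [t|m _].
    exact: filterT.
  by exists 0%N; rewrite cats0.
elim=> [|k IH] ks sP; first by rewrite take0.
rewrite (take_nth 0%N)//; exact: (sP _ ks (IH (ltnW ks) sP)).
Qed.

(** Only finitely many increasing lists lie below [n]. In the induction, those ending in [n] are
    covered by intersecting [T s] with [T (rcons s n)]. *)
Lemma ultra_diagonal (T : seq nat -> set nat) : (forall t, U (T t)) ->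
  forall n, U [set m | forall s, sorted ltn s ->
    all (fun a => (a < n)%N) s -> T s m].
Proof.
move=> TU n; elim: n T TU => [|n IH] T TU.
  have := TU [::]; apply: filterS => m Tm [|a s] //= _.
have TU' s : U (T s `&` T (rcons s n)) by exact: filterI.
have {TU'} := IH _ TU'; apply: filterS => m mP s ss sn.
have [/(mP _ ss)[]//|] := boolP (all (fun a => (a < n)%N) s).
elim/last_ind: s ss sn => [|s a _] //.
rewrite all_rcons (sorted_pairwise ltn_trans) pairwise_rcons.
move=> /andP[sa ss] /andP[an _] nsn.
have aE : a = n.
  apply/eqP; rewrite eqn_leq -ltnS an /= leqNgt; apply: contra nsn => lt.
  rewrite all_rcons lt /=; apply: sub_all sa => b /ltn_trans; exact.
rewrite aE in sa *; have [] // := mP s _ sa.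
by rewrite (sorted_pairwise ltn_trans).
Qed.

(** Diagonalization replaces the tree by sets that depend on the last entry only, with [0] standing
    in for the empty list; chains of [S] are branches of the tree. *)
Lemma ultra_ramsey : exists S : nat -> set nat,
  [/\ forall n, U (S n), forall n m, S n m -> (n < m)%N,
      forall n n', (n <= n')%N -> S n' `<=` S n &
      (forall s, path (uchain S) 0%N s -> Q s) \/
      (forall m, S 0%N (m 0%N) -> (forall i, S (m i) (m i.+1)) ->
         exists k, ~ Q (mkseq m k))].
Proof.
have [T TU TP] := ultra_tree.
pose S n := [set m | (n < m)%N /\ forall s, sorted ltn s ->
  all (fun a => (a < n.+1)%N) s -> T s m].
have ST t a : path (uchain S) 0%N (rcons t a) -> T t a.
  rewrite rcons_path => /andP[pt]; rewrite /uchain inE => -[_].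
  have {}pt : path ltn 0%N t.
    by apply: sub_path pt => x y; rewrite /uchain inE => -[].
  by apply; [exact: path_sorted pt|exact: path_ltn_le_last].
exists S; split => [n|n m []//|n n' nn' m [n'm mT]|].
- apply: filterI; first exact: U_tail.
  exact: ultra_diagonal.
- split=> [|s ss sn]; first exact: leq_ltn_trans n'm.
  apply: mT => //; apply: sub_all sn => a.
  by rewrite !ltnS => /leq_trans; apply.
case: TP => TP;
  [left=> s sS; apply: TP => i is_|right=> m m0 mS; apply: TP => i].
  by apply: ST; rewrite -take_nth//; exact: take_path.
by apply: ST; rewrite -mkseqS; exact: path_mkseq.
Qed.

End UltraTree.

(** * Weakly null subsequences against independent ones *)

Section WeakNullDichotomy.
Variables (R : realType) (X : normedModType R) (a : nat -> X).
Variable U : set_system nat.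
Hypothesis U_ultra : UltraFilter U.
Hypothesis U_tail : forall N, U [set n | (N <= n)%N].
Hypothesis a_null : forall phi, dual_ball phi -> forall e, 0 < e ->
  U [set n | `|phi (a n)| < e].

#[local] Instance U_proper : ProperFilter U := @ultra_proper _ _ U_ultra.

Definition alternates (e : R) (s : seq nat) := exists2 phi, dual_ball phi &
  forall i, (i < size s)%N -> if odd i then phi (a (nth 0%N s i)) <= e / 2
                              else e <= phi (a (nth 0%N s i)).

Lemma increasing_chain (S : nat -> set nat) : (forall n, U (S n)) ->
  exists m, S 0%N (m 0%N) /\ forall i, S (m i) (m i.+1).
Proof.
move=> US; have /choice[g gP] : forall n, exists k, S n k.
  by move=> n; have [k] := filter_ex (US n); exists k.
by exists (fun i => iter i.+1 g 0%N).
Qed.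

(** The odd-indexed members of a chain form [y]; the even-indexed ones are fillers that turn an
    arbitrary pattern into an alternating one. *)
Lemma independent_of_alternating e (S : nat -> set nat) :
  (forall n, U (S n)) -> (forall n m, S n m -> (n < m)%N) ->
  (forall n n', (n <= n')%N -> S n' `<=` S n) ->
  (forall s, path (uchain S) 0%N s -> alternates e s) ->
  exists y : nat -> nat, forall n (b : nat -> bool),
    exists2 phi, dual_ball phi &
    forall i, (i < n)%N ->
      if b i then e <= phi (a (y i)) else phi (a (y i)) <= e / 2.
Proof.
move=> US Slt Ssub Salt; have [m [m0 mS]] := increasing_chain US.
have Str p q r : S p q -> S q r -> S p r.
  by move=> pq; apply: Ssub; exact/ltnW/Slt.
exists (fun i => m i.*2.+1) => n b.
(* inserting [m j.*2] shifts [m j.*2.+1] to a position of the other parity *)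
pose step s j := if odd (size s) == b j then s ++ [:: m j.*2; m j.*2.+1]
                 else rcons s (m j.*2.+1).
pose s := foldl step [::] (iota 0 n).
have [sP [_ sb]] : path (uchain S) 0%N s /\ S (last 0%N s) (m n.*2) /\
    forall i, (i < n)%N ->
      exists p, [/\ (p < size s)%N, nth 0%N s p = m i.*2.+1 & odd p = ~~ b i].
  rewrite {}/s; elim: n => [//|n].
  rewrite -[in iota 0 n.+1]addn1 iotaD foldl_cat add0n /=.
  set s := foldl _ _ _ => -[sP [sl sb]]; rewrite /step.
  have mm : S (m n.*2.+1) (m n.+1.*2) by rewrite doubleS.
  case: eqP => [ob|/eqP/negPf ob].
    split.
      by rewrite cat_path sP /= andbT; apply/andP; split; exact: mem_set.
    split=> [|i]; first by rewrite last_cat.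
    rewrite ltnS leq_eqVlt => /orP[/eqP ->|/sb[p [ps sp op]]].
      exists (size s).+1; rewrite size_cat addn2 ltnSn; split=> //.
        by rewrite nth_cat ltnNge leqnSn /= subSnn.
      by rewrite /= ob.
    exists p; rewrite size_cat ltn_addr// nth_cat ps; split=> //.
  split.
    by rewrite rcons_path sP; apply: mem_set; exact: Str (mS _).
  split=> [|i]; first by rewrite last_rcons.
  rewrite ltnS leq_eqVlt => /orP[/eqP ->|/sb[p [ps sp op]]].
    exists (size s); rewrite size_rcons ltnSn nth_rcons ltnn eqxx; split=> //.
    by move: ob; case: (odd _) (b n) => [] [].
  by exists p; rewrite size_rcons ltnS ltnW// nth_rcons ps.
have [phi phiP phis] := Salt s sP.
exists phi => // i /sb[p [ps <- op]].
by have := phis p ps; rewrite op; case: (b i).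
Qed.

(** Rosenthal's argument: [phi] realizes the sign pattern of [c] and [psi] the opposite one, so
    [phi - psi] gains [e / 2] times the modulus of each coefficient. Its norm is at most [2], whence
    [e / 4]. *)
Lemma l1_lower_of_independent e (y : nat -> nat) : 0 < e ->
  (forall n (b : nat -> bool), exists2 phi, dual_ball phi &
    forall i, (i < n)%N ->
      if b i then e <= phi (a (y i)) else phi (a (y i)) <= e / 2) ->
  forall n (c : nat -> R),
    e / 4 * \sum_(i < n) `|c i| <= `|\sum_(i < n) c i *: a (y i)|.
Proof.
move=> e0 ind n c.
have [phi phiP phib] := ind n (fun i => 0 < c i).
have [psi psiP psib] := ind n (fun i => ~~ (0 < c i)).
set z := \sum_(i < n) c i *: _.
have sumE xi : dual_ball xi -> xi z = \sum_(i < n) c i * xi (a (y i)).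
  move=> xiP; rewrite /z; elim/big_ind2 : _ => [|u1 v1 u2 v2 h1 h2|i _].
  - exact: dual_ball0.
  - by rewrite dual_ballD// h1 h2.
  - exact: dual_ballZ.
have key : e / 2 * \sum_(i < n) `|c i| <= phi z - psi z.
  rewrite !sumE// -sumrB mulr_sumr; apply: ler_sum => i _.
  have := phib i (ltn_ord i); have := psib i (ltn_ord i).
  rewrite -mulrBr; case: ltP => /= ci h1 h2.
    by rewrite gtr0_norm// mulrC ler_pM2l//; lra.
  have -> : e / 2 * `|c i| = c i * - (e / 2) by rewrite ler0_norm//; ring.
  by rewrite ler_wnM2l//; lra.
have [_ /(_ z)] := phiP; have [_ /(_ z)] := psiP.
rewrite !ler_norml => /andP[p1 _] /andP[_ q2]; lra.
Qed.

(** A chain [m] for the diagonal intersection [V] is eventually in every [S k n]. If [phi] were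
    often at least [k.+1%:R^-1] along it, nullity along [U] would supply small values in between,
    hence a chain of [S k] alternating at all lengths. *)
Lemma null_chain : (forall e, 0 < e -> exists S : nat -> set nat,
    [/\ forall n, U (S n), forall n m, S n m -> (n < m)%N,
      forall n n', (n <= n')%N -> S n' `<=` S n &
      forall m, S 0%N (m 0%N) -> (forall i, S (m i) (m i.+1)) ->
         exists k, ~ alternates e (mkseq m k)]) ->
  exists m : nat -> nat, forall phi, dual_ball phi ->
    phi (a (m n)) @[n --> \oo] --> 0.
Proof.
move=> H; have /choice[S SP] : forall k : nat, exists S : nat -> set nat,
    [/\ forall n, U (S n), forall n m, S n m -> (n < m)%N,
      forall n n', (n <= n')%N -> S n' `<=` S n &
      forall m, S 0%N (m 0%N) -> (forall i, S (m i) (m i.+1)) ->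
         exists j, ~ alternates k.+1%:R^-1 (mkseq m j)].
  by move=> k; apply: H; rewrite invr_gt0.
pose V n := \bigcap_(k in [set k | (k <= n)%N]) S k n.
have VU n : U (V n).
  suff : forall j, U [set m | forall k, (k < j)%N -> S k n m].
    by move=> /(_ n.+1); apply: filterS => m h k /= kn; exact: h.
  elim=> [|j IH]; first by apply: filterS filterT => m _ k.
  have [Sj _ _ _] := SP j; apply: filterS (filterI (Sj n) IH) => m [m1 m2] k.
  by rewrite ltnS leq_eqVlt => /orP[/eqP -> //|]; exact: m2.
have [m [m0 mV]] := increasing_chain VU.
have m_lt i : (i <= m i)%N.
  elim: i => // i IH; have [_ lt _ _] := SP 0%N.
  by apply: (leq_ltn_trans IH); apply: lt; exact: (mV i 0%N).
have m_in k n : exists j0, forall j, (j0 <= j)%N -> S k n (m j).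
  exists (maxn k n).+1 => -[//|j]; rewrite ltnS geq_max => /andP[kj nj].
  have [_ _ Ssub _] := SP k.
  apply: (Ssub _ (m j)); first exact: leq_trans nj _.
  by apply: mV; exact: leq_trans kj _.
have upper phi k : dual_ball phi ->
    \forall i \near \oo, phi (a (m i)) < k.+1%:R^-1.
  move=> phiP; set e := k.+1%:R^-1 => /=; have e0 : 0 < e by rewrite invr_gt0.
  apply: contrapT => nlt.
  have often j0 : exists2 j, (j0 <= j)%N & e <= phi (a (m j)).
    apply: contrapT => none; apply: nlt; exists j0 => // j j0j /=.
    by rewrite ltNge; apply/negP => le; apply: none; exists j.
  have [SU Slt Ssub Sout] := SP k.
  have /choice[g gP] : forall n, exists n', S k n n' /\ e <= phi (a n').
    move=> n; have [j0 j0P] := m_in k n; have [j j0j je] := often j0.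
    by exists (m j); split => //; exact: j0P.
  have /choice[h hP] : forall n, exists n', S k n n' /\ phi (a n') <= e / 2.
    move=> n; have e20 : 0 < e / 2 by rewrite divr_gt0.
    have [n' [n'S n'e]] := filter_ex (filterI (SU n) (a_null phiP e20)).
    by exists n'; split => //; rewrite (le_trans (ler_norm _))// ltW.
  (* [w] alternates between members of [m] where [phi] is large and indices,
     provided by [a_null], where it is small. *)
  pose fix w i :=
    if i is i'.+1 then (if odd i then h (w i') else g (w i')) else g 0%N.
  have [|i|j] := Sout w.
  - by have [] := gP 0%N.
  - by rewrite /=; case: (odd i); [have [] := gP (w i)|have [] := hP (w i)].
  apply; exists phi => // i; rewrite size_mkseq => ij; rewrite nth_mkseq//.
  case: i ij => [|i] ij /=; first by have [] := gP 0%N.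
  by case: (odd i) => /=; [have [] := gP (w i)|have [] := hP (w i)].
exists m => phi phiP; apply/cvgrPdist_lt => e e0.
have [k _ /(_ _ (leqnn _))/= ke] := near_infty_natSinv_lt (PosNum e0).
have up := upper phi k phiP; have lo := upper _ k (dual_ball_opp phiP).
apply: filterS (filterI up lo) => i /= [u l].
by rewrite sub0r normrN ltr_norml (lt_trans u ke) ltrNl (lt_trans l ke).
Qed.

Lemma weak_null_dichotomy :
  (exists m : nat -> nat, forall phi, dual_ball phi ->
     phi (a (m n)) @[n --> \oo] --> 0) \/
  (exists (y : nat -> nat) c, 0 < c /\ forall n (d : nat -> R),
    c * \sum_(i < n) `|d i| <= `|\sum_(i < n) d i *: a (y i)|).
Proof.
have [[e [e0 [S [S1 S2 S3 S4]]]]|none] := pselect (exists e, 0 < e /\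
    exists S : nat -> set nat,
      [/\ forall n, U (S n), forall n m, S n m -> (n < m)%N,
      forall n n', (n <= n')%N -> S n' `<=` S n &
      forall s, path (uchain S) 0%N s -> alternates e s]).
  right; have [y yP] := independent_of_alternating S1 S2 S3 S4.
  exists y, (e / 4); split; first by rewrite divr_gt0.
  exact: l1_lower_of_independent.
left; apply: null_chain => e e0.
have [S [S1 S2 S3 [S4|S4]]] := ultra_ramsey (alternates e) U_ultra U_tail.
  by exfalso; apply: none; exists e; split => //; exists S.
by exists S.
Qed.

End WeakNullDichotomy.

(** * Copies of [l1] *)

Section EllOneNorm.
Variable R : realType.
Implicit Types a : ell1 R.

Lemma ell1_partial_le a n : \sum_(i < n) `|a i| <= `|a|.
Proof.
rewrite -(big_mkord xpredT (fun i => `|a i|)).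
apply: (nondecreasing_cvgn_le _ (ell1_cvg (a := a)) n).
by apply: nondecreasing_series => i _ _; exact: normr_ge0.
Qed.

Lemma ell1_norm_le a K : (forall n, \sum_(i < n) `|a i| <= K) -> `|a| <= K.
Proof.
move=> aK; apply: limr_le; first exact: ell1_cvg.
by apply: nearW => n; rewrite seriesEord; exact: aK.
Qed.

Lemma ell1_coord_le a n : `|a n| <= `|a|.
Proof.
rewrite (le_trans _ (ell1_partial_le a n.+1))// big_ord_recr /= lerDr.
by rewrite sumr_ge0.
Qed.

End EllOneNorm.

Section EllOneCopy.
Variables (R : realType) (X : completeNormedModType R) (y : nat -> X) (c M : R).
Hypothesis c_gt0 : 0 < c.
Hypothesis yM : forall n, `|y n| <= M.
Hypothesis y_lower : forall n (d : nat -> R),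
  c * \sum_(i < n) `|d i| <= `|\sum_(i < n) d i *: y i|.

(** For a bounded scalar sequence [y], this is also the functional on [l1] represented by [y]. *)
Definition ell1_comb (a : ell1 R) : X := limn [series a n *: y n]_n.

Let M_ge0 : 0 <= M.
Proof. exact: le_trans (normr_ge0 _) (yM 0). Qed.

Lemma ell1_comb_cvg (a : ell1 R) : [series a n *: y n]_n @ \oo --> ell1_comb a.
Proof.
apply: normed_cvg.
apply: (@series_le_cvg _ _ (M *: (fun n => `|a n| : R^o))) => [n|n|n|] //=.
- by rewrite mulr_ge0.
- by rewrite normrZ mulrC; apply: ler_wpM2r.
- by apply: is_cvg_seriesZ; exact: ell1_cvg.
Qed.

Lemma ell1_comb_linear : linear ell1_comb.
Proof.
move=> k a b; rewrite {1}/ell1_comb; apply/cvg_lim; first exact: norm_hausdorff.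
have -> : [series (k *: a + b) n *: y n]_n =
    (fun n => k *: [series a n *: y n]_n n + [series b n *: y n]_n n).
  apply/funext => n; rewrite !seriesEord /= scaler_sumr -big_split /=.
  by apply: eq_bigr => i _; rewrite scalerDl scalerA.
apply: cvgD; last exact: ell1_comb_cvg.
by apply: cvgZl_tmp; exact: ell1_comb_cvg.
Qed.

Lemma ell1_comb_upper a : `|ell1_comb a| <= M * `|a|.
Proof.
have /cvg_norm h := @ell1_comb_cvg a.
rewrite -(cvg_lim (@Rhausdorff R) h); apply: limr_le.
  by apply/cvg_ex; exists (`|ell1_comb a|).
apply: nearW => n; rewrite seriesEord /= (le_trans (ler_norm_sum _ _ _))//.
rewrite (@le_trans _ _ (\sum_(i < n) M * `|a i|))//.
  by apply: ler_sum => i _; rewrite normrZ mulrC ler_wpM2r.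
by rewrite -mulr_sumr ler_wpM2l// ell1_partial_le.
Qed.

Lemma ell1_comb_lower a : c * `|a| <= `|ell1_comb a|.
Proof.
rewrite mulrC -ler_pdivlMr//; apply: ell1_norm_le => n.
rewrite ler_pdivlMr// mulrC.
have /cvg_norm h := @ell1_comb_cvg a.
rewrite -(cvg_lim (@Rhausdorff R) h); apply: limr_ge.
  by apply/cvg_ex; exists (`|ell1_comb a|).
exists n => // k /= nk; rewrite seriesEord (le_trans _ (y_lower k a))//.
rewrite ler_pM2l//.
rewrite -!(big_mkord xpredT (fun i => `|a i|)).
rewrite (big_cat_nat (leq0n n) nk)//= lerDl.
by rewrite sumr_ge0.
Qed.

Lemma ell1_copy : contains_isomorphic_copy (ell1 R) X.
Proof.
pose T : {linear ell1 R -> X} := HB.pack ell1_comb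
  (GRing.isLinear.Build R (ell1 R) X _ ell1_comb ell1_comb_linear).
have T_inj : injective T.
  move=> a b /eqP; rewrite -subr_eq0 -linearB => /eqP Tab.
  apply/eqP; rewrite -subr_eq0 -normr_le0 -(@ler_pM2l _ c)// mulr0.
  by rewrite (le_trans (ell1_comb_lower _))// -[ell1_comb _]/(T _) Tab normr0.
have /choice[S SP] : forall x, exists a, range T x -> T a = x.
  move=> x; have [[a _ ax]|nx] := pselect (range T x); first by exists a.
  by exists 0 => /nx.
have TS x : range T x -> T (S x) = x by move=> /SP.
exists (range T); split.
  split=> [|k u v]; first by apply/mem_set; exists 0; rewrite ?linear0.
  move=> /set_mem[a _ <-] /set_mem[b _ <-]; apply/mem_set.
  by exists (k *: a + b); rewrite ?linearP.
exists T, S; split => //.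
- apply: bounded_linear_continuous; apply/linear_boundedP.
  near=> r => a; rewrite (le_trans (ell1_comb_upper a))// ler_wpM2r//.
- by move=> a; apply: T_inj; apply: TS; exists a.
- apply/within_continuous_normP => x xT e e0.
  exists (c * e); first exact: mulr_gt0.
  move=> z zT xz; rewrite -(@ltr_pM2l _ c)//.
  rewrite (le_lt_trans (ell1_comb_lower _))//.
  by rewrite -[ell1_comb _]/(T _) linearB !TS.
Unshelve. all: by end_near. Qed.

End EllOneCopy.

Lemma continuous_linear_bound (R : realType) (V W : normedModType R)
    (phi : {linear V -> W}) : continuous phi ->
  exists2 r, 0 < r & forall x, `|phi x| <= r * `|x|.
Proof.
move=> /linear_bounded_continuous /linear_boundedP /pinfty_ex_gt0[r r0 rP].
by exists r.
Qed.

Lemma weakly_cvg0_of_dual_ball (R : realType) (X : normedModType R)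
    (u : nat -> X) :
  (forall phi, dual_ball phi -> phi (u n) @[n --> \oo] --> 0) -> weakly_cvg u 0.
Proof.
move=> H phi /continuous_linear_bound[r r0 rP]; rewrite linear0.
have /H h : dual_ball (fun x => r^-1 * phi x).
  split=> [a x y|x]; first by rewrite linearP mulrDr mulrCA.
  by rewrite normrM gtr0_norm ?invr_gt0// ler_pdivrMl.
have : r * (r^-1 * phi (u n)) @[n --> \oo] --> r * 0.
  by apply: cvgM => //; exact: cvg_cst.
by rewrite mulr0; under eq_cvg do rewrite mulVKf ?gt_eqF//.
Qed.

(** The dichotomy is applied to the differences [z (x n)], bounded because [C] is; its second
    alternative would span a copy of [l1]. *)
Lemma weak_afpp_of_no_ell1 (R : realType) (X : completeNormedModType R) :
  ~ contains_isomorphic_copy (ell1 R) X -> weak_afpp X.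
Proof.
move=> noX C C0 _ cC bC f fC fc.
pose z x := x - f x.
have Cz k (phi : 'I_k -> X -> R) e : 0 < e -> (forall j, dual_ball (phi j)) ->
    exists2 x, C x & forall j, `|phi j (z x)| < e.
  move=> e0 phiP; have e20 : 0 < e / 2 by rewrite divr_gt0.
  have [x Cx xe] := barroso_lin C0 cC bC fC fc phiP e20.
  by exists x => // j; rewrite (le_lt_trans (xe j))//; lra.
have [x [U [xC UU Ut Unull]]] := weak_null_ultrafilter Cz.
have [[m mP]|[y [c [c0 yc]]]] := weak_null_dichotomy UU Ut Unull.
  exists (x \o m); split => [n|]; first exact: xC.
  exact: weakly_cvg0_of_dual_ball.
exfalso; apply: noX.
have /pinfty_ex_gt0[B B0 CB] := bC.
apply: (@ell1_copy _ _ (fun i => z (x (y i))) c (B + B) c0 _ yc) => n.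
by rewrite /z (le_trans (ler_normB _ _))// lerD//; apply: CB => //; exact: fC.
Qed.

(** * The Hahn-Banach theorem *)

Section HahnBanach.
Variables (R : realType) (X : lmodType R) (p : X -> R).
Hypothesis pD : forall x y, p (x + y) <= p x + p y.
Hypothesis pZ : forall t x, 0 <= t -> p (t *: x) = t * p x.

(* Graphs of linear functionals on subspaces; since [- r] is related to [- x]
   whenever [r] is to [x], being dominated by [p] makes such a graph
   functional. *)
Definition dominated_graph (G : set (X * R)) :=
  [/\ G (0, 0),
      forall a u v, G u -> G v -> G (a *: u.1 + v.1, a * u.2 + v.2) &
      forall u, G u -> u.2 <= p u.1].

Lemma dominated_graph_fun G x r s :
  dominated_graph G -> G (x, r) -> G (x, s) -> r = s.
Proof.
move=> [G0 GL Gp].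
have p0 : p 0 = 0 by have := pZ 0 (lexx 0); rewrite scaler0 mul0r.
have aux r1 r2 : G (x, r1) -> G (x, r2) -> r1 <= r2.
  move=> g1 g2; have := Gp _ (GL (-1) _ _ g2 g1).
  by rewrite /= scaleN1r addNr p0 mulN1r addrC subr_le0.
by move=> g1 g2; apply/eqP; rewrite eq_le !aux.
Qed.

(** The value [al] at [x0] must lie between all [u.2 - p (u.1 - x0)] and all [p (u.1 + x0) - u.2];
    by subadditivity the supremum of the former does. *)
Lemma dominated_graph_extend G x0 : dominated_graph G ->
  exists2 B, dominated_graph B & G `<=` B /\ exists r, B (x0, r).
Proof.
move=> [G0 GL Gp].
pose E := [set u.2 - p (u.1 - x0) | u in G].
have Eub u : G u -> ubound E (p (u.1 + x0) - u.2).
  move=> Gu _ [v Gv <-]; rewrite lerBrDr addrAC lerBlDr.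
  rewrite (le_trans _ (pD _ _))// addrACA subrr addr0 addrC.
  by have := Gp _ (GL 1 _ _ Gu Gv); rewrite /= scale1r mul1r addrC.
have hsE : has_sup E.
  split; first by exists (0 - p (0 - x0)); exists (0, 0).
  by exists (p (0 + x0) - 0); exact: (Eub (0, 0)).
pose al := sup E.
have al_ge u : G u -> u.2 - p (u.1 - x0) <= al.
  by move=> Gu; apply: ub_le_sup; [case: hsE|exists u].
have al_le u : G u -> al <= p (u.1 + x0) - u.2.
  by move=> Gu; apply: ge_sup; [case: hsE|exact: Eub].
have Gscale k u : G u -> G (k *: u.1, k * u.2).
  by move=> Gu; have := GL k _ _ Gu G0; rewrite /= !addr0.
exists [set w | exists2 u, G u & exists t, w = (u.1 + t *: x0, u.2 + t * al)].
  split.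
  - by exists (0, 0) => //; exists 0; rewrite /= scale0r mul0r !addr0.
  - move=> a _ _ [u Gu [t ->]] [v Gv [s ->]] /=.
    exists (a *: u.1 + v.1, a * u.2 + v.2); first exact: GL.
    exists (a * t + s) => /=; congr (_, _); last by ring.
    by rewrite scalerDr scalerDl scalerA addrACA.
  (* Homogeneity reduces [t < 0] to [al_ge] and [t > 0] to [al_le]. *)
  - move=> _ [u Gu [t ->]] /=; have [t0|t0|->] := ltgtP t 0.
    + have s0 : 0 < - t by rewrite oppr_gt0.
      have := al_ge _ (Gscale (- t)^-1 _ Gu) => /=.
      rewrite -(ler_pM2l s0) mulrBr mulrA divff ?gt_eqF// mul1r.
      rewrite -(pZ _ (ltW s0)) scalerBr scalerA divff ?gt_eqF// scale1r.
      rewrite scaleNr opprK; lra.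
    + have := al_le _ (Gscale t^-1 _ Gu) => /=.
      rewrite -(ler_pM2l t0) mulrBr mulrA divff ?gt_eqF// mul1r.
      rewrite -(pZ _ (ltW t0)) scalerDr scalerA divff ?gt_eqF// scale1r.
      lra.
    + by rewrite scale0r mul0r !addr0; exact: Gp.
split=> [u Gu|].
  by exists u => //; exists 0; rewrite scale0r mul0r !addr0; case: u {Gu}.
by exists al; exists (0, 0) => //; exists 1; rewrite /= scale1r mul1r !add0r.
Qed.

Lemma hahn_banach (G : set (X * R)) : dominated_graph G ->
  exists phi : X -> R, [/\ forall a x y, phi (a *: x + y) = a * phi x + phi y,
    forall x r, G (x, r) -> phi x = r & forall x, phi x <= p x].
Proof.
move=> Gd.
(* The condition bears on the union of [G] and [A], so that the empty union of the empty chain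
   satisfies it. *)
have [|A [Ad Amax]] := @Zorn_bigcup _ (fun A => dominated_graph (G `|` A)).
  move=> F FP Ftot; have [G0 GL Gp] := Gd; split.
  - by left.
  - move=> a u v [Gu|[A FA Au]] [Gv|[B FB Bv]]; first by left; exact: GL.
    + have [_ L _] := FP _ FB.
      by have [|h] := L a u v (or_introl Gu) (or_intror Bv);
        [left|right; exists B].
    + have [_ L _] := FP _ FA.
      by have [|h] := L a u v (or_intror Au) (or_introl Gv);
        [left|right; exists A].
    + have [AB|BA] := Ftot _ _ FA FB.
        have [_ L _] := FP _ FB.
        by have [|h] := L a u v (or_intror (AB _ Au)) (or_intror Bv);
          [left|right; exists B].
      have [_ L _] := FP _ FA.
      by have [|h] := L a u v (or_intror Au) (or_intror (BA _ Bv));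
        [left|right; exists A].
  - move=> u [/Gp//|[A FA Au]]; have [_ _] := FP _ FA; apply.
    by right.
have /choice[phi phiP] : forall x, exists r, (G `|` A) (x, r).
  move=> x0; have [B Bd [GAB [r Br]]] := dominated_graph_extend x0 Ad.
  exists r; apply: contrapT => nr.
  apply: (Amax B); last first.
    by rewrite (_ : G `|` B = B)//; apply/setUidPr => u Gu; apply: GAB; left.
  split; first by move=> u Au; apply: GAB; right.
  by move=> BA; apply: nr; right; exact: BA.
have [_ L P] := Ad.
exists phi; split=> [a x y|x r Gr|x]; last exact: (P _ (phiP x)).
- exact: dominated_graph_fun Ad (phiP _) (L a _ _ (phiP x) (phiP y)).
- by apply: (dominated_graph_fun Ad (phiP _)); left.
Qed.

End HahnBanach.

(** * Schur's property of [l1] *)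

Section EllOneMore.
Variable R : realType.

Lemma ell1_of_bounded (u : nat -> R) K : (forall n, \sum_(i < n) `|u i| <= K) ->
  exists2 a : ell1 R, forall i, a i = u i & `|a| <= K.
Proof.
move=> uK; have ucvg : cvgn [series `|u n|]_n.
  apply: nondecreasing_is_cvgn.
    by apply: nondecreasing_series => i _ _; exact: normr_ge0.
  by exists K => _ [n _ <-]; rewrite seriesEord; exact: uK.
have us : (u : nat -> R^o) \in @abs_summable R by rewrite abs_summableP.
by exists (Ell1 us) => //; apply: ell1_norm_le.
Qed.

Lemma ell1_partial_cvg (a : ell1 R) e : 0 < e ->
  exists N, forall n, (N <= n)%N -> `|a| - \sum_(i < n) `|a i| < e.
Proof.
move=> e0; have /cvgrPdist_lt/(_ e e0) : [series `|a n|]_n @ \oo --> `|a|.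
  exact: ell1_cvg.
move=> [N _ NP]; exists N => n Nn; have := NP n Nn.
by rewrite /= seriesEord; apply: le_lt_trans; exact: ler_norm.
Qed.

Lemma ell1_small_tail (a : ell1 R) e : 0 < e ->
  exists N, forall j, (N <= j)%N -> `|a j| < e.
Proof.
move=> /(ell1_partial_cvg a)[N NP]; exists N => j Nj.
apply: le_lt_trans (NP j Nj); rewrite lerBrDr addrC.
by have := ell1_partial_le a j.+1; rewrite big_ord_recr.
Qed.

(** Preimages of an approximating sequence are Cauchy by the lower bound on [T]. Their limit is
    taken coordinatewise along an ultrafilter, and bounds on partial sums pass to it. *)
Lemma ell1_image_closed (X : normedModType R) (T : {linear ell1 R -> X}) c K r :
  0 < c -> (forall a, c * `|a| <= `|T a|) -> (forall a, `|T a| <= K * `|a|) ->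
  closed [set T a | a in [set a | `|a| <= r]].
Proof.
move=> c0 Tc TK x xcl.
have /choice[a aP] : forall n : nat, exists a,
    `|a| <= r /\ `|x - T a| < n.+1%:R^-1.
  move=> n; have [|_ [[a ar <-]]] := xcl (ball x n.+1%:R^-1).
    by apply: nbhsx_ballx; rewrite invr_gt0.
  by rewrite -ball_normE => xa; exists a.
have [U [UU Unat]] := ultraFilterLemma eventually_filter.
have UF : ProperFilter U := @ultra_proper _ _ UU.
have /choice[al alP] : forall j, exists l : R, a n j @[n --> U] --> l.
  move=> j; have [|l _ lP] := @ultra_bounded_cvg R _ U (fun n => a n j) r UU.
    apply: nearW => n; have [ar _] := aP n.
    exact: le_trans (ell1_coord_le _ _) ar.
  by exists l.
have dist m N : \sum_(j < N) `|a m j - al j| <= 2 / m.+1%:R / c.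
  have h : \sum_(j < N) `|a m j - a n j| @[n --> U] -->
      \sum_(j < N) `|a m j - al j|.
    apply: cvg_big => [|j _]; first exact: add_continuous.
    by apply: cvg_norm; apply: cvgB => //; exact: cvg_cst.
  rewrite -(cvg_lim (@Rhausdorff R) h); apply: limr_le.
    by apply/cvg_ex; eexists; exact: h.
  apply: Unat; exists m => // n /= mn.
  rewrite (le_trans (ell1_partial_le (a m - a n) N))//.
  rewrite ler_pdivlMr// mulrC (le_trans (Tc _))// linearB.
  have [_ xm] := aP m; have [_ xn] := aP n.
  have nm : n.+1%:R^-1 <= m.+1%:R^-1 :> R.
    by rewrite lef_pV2 ?posrE ?ltr0n// ler_nat.
  rewrite (le_trans (ler_distD x _ _))// distrC.
  by rewrite mulr_natl mulr2n lerD// ltW// (lt_le_trans xn).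
(* [al] is summable because its difference from [a 0%N] is. *)
have [b0 b0P _] := @ell1_of_bounded (fun j => a 0%N j - al j) _ (dist 0%N).
pose al' : ell1 R := a 0%N - b0.
have alE j : al' j = al j.
  by rewrite -[al' j]/(a 0%N j - b0 j) b0P opprB addrC subrK.
have dist' m : `|a m - al'| <= 2 / m.+1%:R / c.
  apply: ell1_norm_le => n; apply: le_trans (dist m n).
  apply: ler_sum => j _; rewrite -[(a m - al') j]/(a m j - al' j).
  by rewrite alE.
have small (e : R) : 0 < e -> exists m : nat, m.+1%:R^-1 < e.
  move=> e0.
  have [m _ /(_ _ (leqnn _)) me] := near_infty_natSinv_lt (PosNum e0).
  by exists m.
exists al'.
  rewrite /= leNgt; apply/negP => lt.
  have e0 : 0 < (`|al'| - r) * c / 2 by rewrite divr_gt0// mulr_gt0// subr_gt0.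
  have [m me] := small _ e0; have [am _] := aP m.
  have dm : 2 / m.+1%:R / c < `|al'| - r.
    by rewrite ltr_pdivrMr// mulrC -ltr_pdivlMr.
  have := le_lt_trans (dist' m) dm; rewrite ltrBrDr ltNge => /negP; apply.
  rewrite -[`|al'|]normrN -[in leLHS]sub0r (le_trans (ler_distD (a m) _ _))//.
  by rewrite sub0r normrN addrC lerD2l.
apply/eqP; rewrite -subr_eq0 -normr_le0 leNgt; apply/negP => gt0.
have K0 : 0 < 1 + 2 * `|K| / c.
  by rewrite ltr_pwDl// divr_ge0 ?mulr_ge0// ltW.
have [m me] := small _ (divr_gt0 gt0 K0).
have [_ xm] := aP m.
have : `|T al' - x| <= m.+1%:R^-1 * (1 + 2 * `|K| / c).
  rewrite (le_trans (ler_distD (T (a m)) _ _))// mulrDr mulr1 addrC.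
  rewrite lerD//; first by rewrite distrC ltW.
  rewrite -linearB (le_trans (TK _))//.
  have -> : m.+1%:R^-1 * (2 * `|K| / c) = `|K| * (2 / m.+1%:R / c) by ring.
  rewrite (@le_trans _ _ (`|K| * `|al' - a m|))//.
    by rewrite ler_wpM2r// ler_norm.
  by rewrite ler_wpM2l// distrC.
by rewrite leNgt -ltr_pdivlMr// me.
Qed.

End EllOneMore.

Section Schur.
Variables (R : realType) (v : nat -> ell1 R).
Hypothesis v_weak : forall b : nat -> R^o, (forall j, `|b j| <= 1) ->
  (ell1_comb b (v n) : R^o) @[n --> \oo] --> (0 : R^o).

Lemma weak_null_coord j : v n j @[n --> \oo] --> (0 : R).
Proof.
have b1 i : `|(i == j)%:R : R^o| <= 1.
  by case: (i == j); rewrite ?normr1 ?normr0.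
have := v_weak b1; apply: cvg_trans; apply: near_eq_cvg; apply: nearW => n.
apply/cvg_lim; first exact: Rhausdorff.
apply: cvg_near_cst; exists j.+1 => // k /= jk.
rewrite seriesEord /= (bigD1 (Ordinal jk))//= eqxx big1 ?addr0.
  by rewrite -[LHS]/(v n j * 1) mulr1.
by move=> i ij; rewrite (negPf ij : (i == j :> nat) = false) scaler0.
Qed.

(** Gliding hump: otherwise some terms [v n] concentrate, up to [d / 8] on either side, on
    successive disjoint blocks. Their signs there form one bounded sequence [b] whose pairing with
    them stays at least [d / 2]. *)
Lemma schur_not_bounded_below d : 0 < d -> exists n, `|v n| < d.
Proof.
move=> d0; apply: contrapT => nsmall.
have vd n : d <= `|v n|.
  by rewrite leNgt; apply/negP => lt; apply: nsmall; exists n.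
have d8 : 0 < d / 8 by rewrite divr_gt0.
pose S n N := \sum_(i < N) `|v n i|.
have SN n N N' : (N <= N')%N -> S n N <= S n N'.
  move=> NN; rewrite /S -!(big_mkord xpredT (fun i => `|v n i|)).
  by rewrite (big_cat_nat (leq0n N) NN)//= lerDl sumr_ge0.
have head N : exists2 n, (N <= n)%N & S n N < d / 8.
  have h : S n N @[n --> \oo] --> \sum_(i < N) `|0 : R|.
    apply: cvg_big => [|j _]; first exact: add_continuous.
    by apply: cvg_norm; exact: weak_null_coord.
  rewrite big1 in h; last by move=> i _; rewrite normr0.
  have [n0 _ n0P] := cvgr_lt _ h _ d8.
  by exists (maxn n0 N); [exact: leq_maxr|apply: n0P => /=; exact: leq_maxl].
(* From the start [N] of a block, [p] gives the index of a term and the end of the block. *)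
have /choice[p pP] : forall N, exists p : nat * nat,
    [/\ (N <= p.1)%N, (N < p.2)%N, S p.1 N < d / 8 &
        `|v p.1| - S p.1 p.2 < d / 8].
  move=> N; have [n Nn nS] := head N.
  have [N' N'P] := ell1_partial_cvg (v n) d8.
  exists (n, maxn N' N.+1); split => //=; first exact: leq_maxr.
  by apply: N'P; exact: leq_maxl.
pose M := fix M k := if k is k'.+1 then (p (M k')).2 else 0%N.
have M_lt k : (M k < M k.+1)%N by have [] := pP (M k).
have M_mono k l : (k <= l)%N -> (M k <= M l)%N.
  move=> /subnK <-; elim: (l - k)%N => // i IH.
  by rewrite addSn (leq_trans IH)// ltnW.
have M_ge k : (k <= M k)%N by elim: k => // k IH; exact: leq_ltn_trans (M_lt k).
have blockP j : exists k, (j < M k.+1)%N by exists j; exact: M_ge.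
pose blk j := ex_minn (blockP j).
have blkE k j : (M k <= j)%N -> (j < M k.+1)%N -> blk j = k.
  move=> kj jk; rewrite /blk; case: ex_minnP => l jl lmin.
  apply/eqP; rewrite eqn_leq lmin//= leqNgt; apply/negP => lk.
  by have := leq_trans (leq_trans jl (M_mono _ _ lk)) kj; rewrite ltnn.
pose b j : R^o := Num.sg (v (p (M (blk j))).1 j).
have b1 j : `|b j| <= 1 by rewrite normr_sg; case: (_ != 0).
have big k : d / 2 <= ell1_comb b (v (p (M k)).1).
  have [_ _ h1 h2] := pP (M k); set n := (p (M k)).1 in h1 h2 *.
  apply: limr_ge.
    by apply/cvg_ex; eexists; exact: (@ell1_comb_cvg _ _ _ 1 b1).
  exists (M k.+1) => // N /= kN; rewrite seriesEord /=.
  have kN' := leq_trans (ltnW (M_lt k)) kN.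
  (* Inside the block [b] yields the modulus of each coordinate, outside at least its opposite. As
     both errors are below [d / 8], the loss from the norm is at most [d / 2]. *)
  have lowb : 2 * S n (M k.+1) - 2 * S n (M k) - S n N <=
      \sum_(i < N) v n i *: b i.
    rewrite /S -!(big_mkord xpredT (fun i => `|v n i|)).
    rewrite -(big_mkord xpredT (fun i => v n i *: b i)).
    rewrite !(big_cat_nat (leq0n (M k)) (ltnW (M_lt k)))//=.
    rewrite !(big_cat_nat (leq0n (M k)) kN')//=.
    rewrite !(big_cat_nat (ltnW (M_lt k)) kN)//=.
    set A := \sum_(0 <= i < M k) `|v n i|.
    set B := \sum_(M k <= i < M k.+1) `|v n i|.
    set C := \sum_(M k.+1 <= i < N) `|v n i|.
    have gen i : - `|v n i| <= v n i *: b i.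
      have : `|v n i *: b i| <= `|v n i| by rewrite normrZ ler_piMr.
      by rewrite ler_norml => /andP[].
    have a1 : - A <= \sum_(0 <= i < M k) v n i *: b i.
      by rewrite -sumrN; apply: ler_sum => i _.
    have c1 : - C <= \sum_(M k.+1 <= i < N) v n i *: b i.
      by rewrite -sumrN; apply: ler_sum => i _.
    have b1' : B = \sum_(M k <= i < M k.+1) v n i *: b i.
      apply: eq_big_nat => i /andP[ki ik]; rewrite /b (blkE k)// -/n.
      by rewrite -[_ *: _]/(v n i * Num.sg (v n i)) mulrC -normrEsg.
    rewrite -b1'; lra.
  apply: le_trans lowb; have := vd n; have := ell1_partial_le (v n) N.
  rewrite -/(S n N); lra.
have /cvgr_lt/(_ (d / 2)) := v_weak b1.
have -> : (0 < d / 2)%R by rewrite divr_gt0.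
move=> /(_ isT)[n0 _ n0P]; have [h _ _ _] := pP (M n0).
have := n0P _ (leq_trans (M_ge n0) h); rewrite /= ltNge.
by rewrite big.
Qed.

End Schur.

(** * A displaced self-map of the ball of [l1] *)

Lemma near_norm (R : realType) (V : normedModType R) (x : V) (d : R)
    (P : set V) : 0 < d -> (forall y, `|x - y| < d -> P y) -> nbhs x P.
Proof.
move=> d0 H; apply/nbhs_ballP; exists d => //= y.
by rewrite -ball_normE; exact: H.
Qed.

Lemma continuous_of_dist_le (R : realType) (V W : normedModType R)
    (f : V -> W) :
  (forall x y, `|f x - f y| <= `|x - y|) -> continuous f.
Proof.
move=> H x; apply/cvgrPdist_lt => e e0; apply: (near_norm e0) => y.
exact: le_lt_trans (H x y).
Qed.

Lemma continuous_near_eq (R : realType) (V W : normedModType R) (f g : V -> W)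
    (x : V) (d : R) : 0 < d -> (forall y, `|x - y| < d -> f y = g y) ->
  {for x, continuous g} -> {for x, continuous f}.
Proof.
move=> d0 H gx; rewrite /prop_for /continuous_at H ?subrr ?normr0//.
apply: cvg_trans gx; apply: near_eq_cvg; apply: (near_norm d0) => y xy.
by rewrite H.
Qed.

Section DisplacedMap.
Variable R : realType.
Implicit Types (a : ell1 R) (t : R).

Lemma ell1_unit_ex (n : nat) :
  exists2 a : ell1 R, forall i, a i = (i == n)%:R & `|a| <= 1.
Proof.
apply: ell1_of_bounded => N; have [nN|nN] := ltnP n N.
  rewrite (bigD1 (Ordinal nN))//= eqxx normr1 big1 ?addr0// => i ni.
  by rewrite (negPf ni : (i == n :> nat) = false) normr0.
by rewrite big1// => i _; rewrite ltn_eqF ?normr0// (leq_trans (ltn_ord i)).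
Qed.

Definition ell1_unit n : ell1 R := sval (cid2 (ell1_unit_ex n)).

Lemma ell1_unitE n i : ell1_unit n i = (i == n)%:R.
Proof. by rewrite /ell1_unit; case: cid2. Qed.

Lemma ell1_unit_norm n : `|ell1_unit n| <= 1.
Proof. by rewrite /ell1_unit; case: cid2. Qed.

(* [x + `|x|] is twice the positive part of [x]. *)
Definition hat (s : R) : R := (1 - `|s|) + `|1 - `|s| |.

Lemma hat_ge0 s : 0 <= hat s.
Proof.
by rewrite /hat; have := ler_norm (- (1 - `|s|)); rewrite normrN; lra.
Qed.

Lemma hat_le2 s : hat s <= 2.
Proof.
rewrite /hat; have [h|h] := leP 0 (1 - `|s|).
  by rewrite (ger0_norm h); have := normr_ge0 s; lra.
by rewrite (ltr0_norm h) subrr.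
Qed.

Lemma hat_eq0 s : 1 <= `|s| -> hat s = 0.
Proof. by move=> s1; rewrite /hat [`|1 - _|]ler0_norm ?subrr// subr_le0. Qed.

Lemma hat_ge1 s : `|s| <= 1 / 2 -> 1 <= hat s.
Proof. by move=> s1; rewrite /hat [`|1 - _|]ger0_norm; lra. Qed.

Lemma hat_continuous : continuous hat.
Proof.
move=> s; have h : 1 - `|x| @[x --> s] --> 1 - `|s|.
  by apply: cvgB; [exact: cvg_cst|exact: cvg_norm].
by apply: cvgD => //; exact: cvg_norm.
Qed.

Definition path_point_upto (N : nat) t : ell1 R :=
  \sum_(j < N) hat (t - j%:R) *: ell1_unit j.

(** All later terms of the series vanish. At an integer [t = n] the point is twice the unit vector
    of index [n]. *)
Definition path_point t := path_point_upto (Num.truncn t).+2 t.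

Lemma hat_far t j : (Num.truncn t + 2 <= j)%N -> hat (t - j%:R) = 0.
Proof.
move=> tj; apply: hat_eq0; have := truncnS_gt t.
have : ((Num.truncn t).+1%:R + 1 : R) <= j%:R.
  by rewrite -[1]/(1%:R) -natrD ler_nat addn1 -addn2.
move=> h1 h2; rewrite distrC (le_trans _ (ler_norm _))//; lra.
Qed.

Lemma path_pointE N t : (Num.truncn t + 2 <= N)%N ->
  path_point t = path_point_upto N t.
Proof.
rewrite addn2 => tN; rewrite /path_point /path_point_upto.
rewrite -!(big_mkord xpredT (fun j => hat (t - j%:R) *: ell1_unit j)).
rewrite [RHS](big_cat_nat (leq0n _) tN)//= [X in _ + X]big1_seq ?addr0//.
move=> j /=; rewrite mem_index_iota => /andP[tj _].
by rewrite hat_far ?scale0r// addn2.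
Qed.

Lemma ell1_sum_coord N (w : nat -> R) (e : nat -> ell1 R) i :
  (\sum_(j < N) w j *: e j) i = \sum_(j < N) w j * e j i.
Proof. by elim/big_ind2 : _ => // u1 v1 u2 v2 <- <-. Qed.

Lemma path_point_coord t i : path_point t i = hat (t - i%:R).
Proof.
pose N := (Num.truncn t + 2 + i.+1)%N.
have iN : (i < N)%N by rewrite /N addnS ltnS leq_addl.
rewrite (@path_pointE N) ?leq_addr//.
rewrite /path_point_upto (ell1_sum_coord N (fun j => hat (t - j%:R))).
rewrite (bigD1 (Ordinal iN))//= ell1_unitE eqxx mulr1 big1 ?addr0// => j ji.
rewrite ell1_unitE eq_sym.
by rewrite (negPf ji : (j == i :> nat) = false) mulr0.
Qed.

(** At most two consecutive terms are nonzero, each of norm at most [2]. *)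
Lemma path_point_norm t : 0 <= t -> `|path_point t| <= 4.
Proof.
move=> t0; rewrite /path_point /path_point_upto !big_ord_recr /=.
rewrite big1 ?add0r => [|j _]; last first.
  rewrite hat_eq0 ?scale0r//; have /andP[h _] := truncn_itv t0.
  have : (j%:R + 1 : R) <= (Num.truncn t)%:R.
    by rewrite -[1]/(1%:R) -natrD ler_nat addn1.
  by move=> h1; rewrite (le_trans _ (ler_norm _))//; lra.
have b s n : `|hat s *: ell1_unit n| <= 2.
  rewrite normrZ ger0_norm ?hat_ge0//.
  rewrite -[2]mulr1 ler_pM ?hat_ge0 ?hat_le2//; exact: ell1_unit_norm.
rewrite (le_trans (ler_normD _ _))//.
by rewrite (le_trans (lerD (b _ _) (b _ _)))//; lra.
Qed.

Lemma path_point_continuous : continuous path_point.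
Proof.
move=> t0; pose N := (Num.truncn (`|t0| + 1)).+3.
apply: (@continuous_near_eq R R^o _ _ (path_point_upto N) t0 1) => // [t tt|].
  apply: path_pointE; rewrite /N addn2 !ltnS ltnW// ltnS le_truncn//.
  have := ler_norm t0; have := ler_norm (t - t0); rewrite distrC; lra.
move: t0 @N => t0 N.
apply: continuous_big => [|j _]; first exact: add_continuous.
move=> t; apply: (@continuousZr_tmp _ _ R^o (fun t => hat (t - j%:R)) _ t).
apply: (@continuous_comp _ _ _ (fun t => t - j%:R) hat).
  by apply: cvgB => //; exact: cvg_cst.
exact: hat_continuous.
Qed.

(** Twice the positive part of [4 * s - 1]. *)
Definition bump (s : R) : R := (4 * s - 1) + `|4 * s - 1|.

Lemma bump_ge0 s : 0 <= bump s.
Proof.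
by rewrite /bump; have := ler_norm (- (4 * s - 1)); rewrite normrN; lra.
Qed.

Lemma bump_eq0 s : s <= 1 / 4 -> bump s = 0.
Proof. by move=> s1; rewrite /bump ler0_norm ?subrr//; lra. Qed.

Lemma bump_ge1 s : 3 / 8 <= s -> 1 <= bump s.
Proof. by move=> s1; rewrite /bump ger0_norm; lra. Qed.

Lemma bump_continuous : continuous bump.
Proof.
move=> s; have h : 4 * x - 1 @[x --> s] --> 4 * s - 1.
  by apply: cvgB; [apply: cvgM => //; exact: cvg_cst|exact: cvg_cst].
by apply: cvgD => //; exact: cvg_norm.
Qed.

(** Only finitely many coordinates exceed [1 / 4], so the sum is finite. The weight [j.+1] puts the
    position at or beyond [j.+1] once coordinate [j] reaches [3 / 8]. *)
Definition position a : R := limn [series j.+1%:R * bump (a j)]_j.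

Lemma positionE N a : (forall j, (N <= j)%N -> a j <= 1 / 4) ->
  position a = \sum_(j < N) j.+1%:R * bump (a j).
Proof.
move=> aN; apply/cvg_lim; first exact: Rhausdorff.
apply: cvg_near_cst; exists N => // k /= Nk.
rewrite seriesEnat /= (big_cat_nat (leq0n _) Nk)//= big_mkord.
rewrite [X in _ + X]big1_seq ?addr0// => j /=.
by rewrite mem_index_iota => /andP[Nj _]; rewrite bump_eq0 ?mulr0// aN.
Qed.

Lemma coord_continuous_ell1 j : continuous (fun a => a j : R).
Proof.
apply: (@continuous_of_dist_le R (ell1 R) R^o) => a b.
exact: (ell1_coord_le (a - b) j).
Qed.

(** Within [1 / 8] of [a], coordinates that are below [1 / 8] for [a] stay below [1 / 4], so one
    finite sum serves all nearby points. *)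
Lemma position_continuous : continuous position.
Proof.
move=> a; have e8 : 0 < 1 / 8 :> R by rewrite divr_gt0.
have [N NP] := ell1_small_tail a e8.
apply: (@continuous_near_eq R (ell1 R) R^o _
    (fun b => \sum_(j < N) j.+1%:R * bump (b j)) a (1 / 8)) => // [b ab|].
  apply: positionE => j /NP aj.
  have := ell1_coord_le (a - b) j; rewrite -[(a - b) j]/(a j - b j) => h.
  have := ler_norm (a j); have := ler_norm (b j - a j); rewrite distrC; lra.
move: a {NP}; apply: continuous_big => [|j _]; first exact: add_continuous.
move=> a.
apply: (@continuousM _ _ (fun=> j.+1%:R) (fun b : ell1 R => bump (b j)) a).
  exact: cst_continuous.
apply: (@continuous_comp _ _ _ (fun b : ell1 R => b j : R) bump).
  exact: coord_continuous_ell1.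
exact: bump_continuous.
Qed.

Lemma position_ge a j : j.+1%:R * bump (a j) <= position a.
Proof.
have [N NP] := @ell1_small_tail _ a (1 / 4) ltac:(by rewrite divr_gt0).
rewrite (@positionE (N + j.+1)) => [|i Ni]; last first.
  rewrite ltW// (le_lt_trans (ler_norm _))// NP//.
  exact: leq_trans (leq_addr _ _) Ni.
have jN : (j < N + j.+1)%N by rewrite addnS ltnS leq_addl.
rewrite (bigD1 (Ordinal jN))//= lerDl sumr_ge0// => i _.
by rewrite mulr_ge0 ?bump_ge0.
Qed.

Lemma position_ge0 a : 0 <= position a.
Proof. by rewrite (le_trans _ (position_ge a 0))// mulr_ge0 ?bump_ge0. Qed.

Definition displace a := path_point (position a).

Lemma displace_continuous : continuous displace.
Proof.
move=> a; apply: continuous_comp; first exact: position_continuous.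
exact: path_point_continuous.
Qed.

Lemma displace_norm a : `|displace a| <= 4.
Proof. by apply: path_point_norm; exact: position_ge0. Qed.

(* If [a] were close to [path_point t] with [t = position a], then [a] would
   have a large coordinate at the integer nearest to [t], which forces
   [position a > t]. *)
Lemma displace_far a : 1 / 8 <= `|a - displace a|.
Proof.
rewrite leNgt; apply/negP => close; set t := position a.
have t0 : 0 <= t := position_ge0 a.
have [n nt nt1] : exists2 n : nat, `|t - n%:R| <= 1 / 2 & t < n.+1%:R.
  have /andP[t1 t2] := truncn_itv t0.
  have [h|h] := leP (t - (Num.truncn t)%:R) (1 / 2).
    by exists (Num.truncn t) => //; rewrite ger0_norm// subr_ge0.
  exists (Num.truncn t).+1.
    by rewrite ler_norml; move: t1 t2 h; rewrite -natr1; lra.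
  by rewrite (lt_trans t2)// ltr_nat.
have := ell1_coord_le (a - displace a) n.
rewrite -[(a - displace a) n]/(a n - displace a n) path_point_coord -/t => h.
have h1 := hat_ge1 nt.
have an : 3 / 8 <= a n.
  have := le_lt_trans h close; rewrite ltr_norml => /andP[h2 h3]; lra.
have := position_ge a n; rewrite leNgt => /negP; apply.
rewrite -/t (lt_le_trans nt1)// ler_peMr// bump_ge1//.
Qed.

End DisplacedMap.

(** * The equivalence *)

Section ConverseDirection.
Variables (R : realType) (X : normedModType R) (T : {linear ell1 R -> X}).

(** Continuity of [S] at [0] gives a radius [d] below which preimages have norm less than [1]; the
    rest is homogeneity. *)
Lemma homeomorphism_lower (S : X -> ell1 R) : cancel T S ->
  {within range T, continuous S} ->
  exists2 c, 0 < c & forall a, c * `|a| <= `|T a|.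
Proof.
move=> TS /within_continuous_normP Sc.
have T0 : range T 0 by exists 0; rewrite ?linear0.
have [d d0 dP] := Sc 0 T0 1 ltr01.
have S0 : S 0 = 0 by rewrite -[0 in LHS](linear0 T) TS.
have small a : `|T a| < d -> `|a| < 1.
  move=> ad; have := dP (T a) (ex_intro2 _ _ a I erefl).
  by rewrite TS S0 !sub0r !normrN; apply.
exists (d / 2) => [|a]; first by rewrite divr_gt0.
have [->|a0] := eqVneq a 0; first by rewrite linear0 !normr0 mulr0.
rewrite leNgt; apply/negP => lt; have na : 0 < `|a| by rewrite normr_gt0.
have := small (`|a|^-1 *: a); rewrite linearZ !normrZ normfV normr_id.
rewrite mulVf ?gt_eqF// ltxx => h; apply: notF; apply: h.
by rewrite ltr_pdivrMl// (lt_trans lt)// mulrC ltr_pM2l//; lra.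
Qed.

(** Carried to the range of [T], the functional [ell1_comb b] is dominated by [c^-1] times the norm,
    so Hahn-Banach extends it. *)
Lemma extend_comb (b : nat -> R^o) c : 0 < c ->
  (forall a, c * `|a| <= `|T a|) -> (forall j, `|b j| <= 1) ->
  exists phi : {linear X -> R^o}, continuous phi /\
    forall a, phi (T a) = ell1_comb b a.
Proof.
move=> c0 Tc b1; pose p (x : X) := c^-1 * `|x|.
have pD x y : p (x + y) <= p x + p y.
  by rewrite /p -mulrDr ler_pM2l ?invr_gt0// ler_normD.
have pZ t x : 0 <= t -> p (t *: x) = t * p x.
  by move=> t0; rewrite /p normrZ ger0_norm// mulrCA.
pose G := [set (T a, ell1_comb b a : R) | a in [set: ell1 R]].
have lin := ell1_comb_linear b1.
have comb0 : ell1_comb b 0 = 0.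
  apply/eqP; rewrite -normr_le0 -[leRHS](mulr0 1) -(normr0 (ell1 R)).
  exact: ell1_comb_upper.
have Gd : dominated_graph p G.
  split=> [|k _ _ [a1 _ <-] [a2 _ <-] /=|_ [a _ <-] /=].
  - by exists 0; rewrite // linear0 comb0.
  - by exists (k *: a1 + a2); rewrite // linearP lin.
  - rewrite (le_trans (ler_norm _))// (le_trans (ell1_comb_upper b1 _))//.
    by rewrite mul1r /p ler_pdivlMl.
have [phi [philin phiG phip]] := hahn_banach pD pZ Gd.
pose phi' : {linear X -> R^o} := HB.pack phi
  (GRing.isLinear.Build R X R^o _ phi philin).
exists phi'; split; last by move=> a; apply: phiG; exists a.
apply: bounded_linear_continuous; apply/linear_boundedP.
near=> r => x; rewrite (@le_trans _ _ (p x))//; last first.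
  by rewrite /p ler_wpM2r.
rewrite ler_norml; apply/andP; split; last exact: phip.
rewrite lerNl -[- _]linearN (le_trans (phip _))// /p normrN//.
Unshelve. all: by end_near. Qed.

Lemma linear_image_convex r : convex_set [set T a | a in [set a | `|a| <= r]].
Proof.
move=> x y t; rewrite !inE => -[a ar <-] [b br <-].
exists (t%:num *: a + (1 - t%:num) *: b); last by rewrite linearD !linearZ.
have t0 : 0 <= t%:num :> R by [].
have t1 : 0 <= 1 - t%:num :> R by rewrite subr_ge0.
rewrite /= (le_trans (ler_normD _ _))// !normrZ !ger0_norm//.
rewrite (le_trans (lerD (ler_wpM2l t0 ar) (ler_wpM2l t1 br)))//.
by rewrite -mulrDl addrC subrK mul1r.
Qed.

End ConverseDirection.

(** [T] carries [displace] to the image [C] of the ball of radius [4], which contains all its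
    values. The differences pull back to [v n] of norm at least [1 / 8], yet weakly null in [l1],
    against Schur's theorem. *)
Lemma no_ell1_of_weak_afpp (R : realType) (X : normedModType R) :
  weak_afpp X -> ~ contains_isomorphic_copy (ell1 R) X.
Proof.
move=> wX [Y [_ [T [S [TY Tcont TS Scont]]]]].
rewrite -TY in Scont.
have [c c0 Tc] := homeomorphism_lower TS Scont.
have [K K0 TK] := continuous_linear_bound Tcont.
pose C := [set T a | a in [set a | `|a| <= 4]].
have CT : C `<=` range T by move=> _ [a _ <-]; exists a.
pose f x := T (displace (S x)).
have fC : set_fun C C f.
  by move=> _ [a _ <-]; exists (displace (S (T a))) => //; exact: displace_norm.
have fcont : {within C, continuous f}.
  apply: (@within_continuous_comp _ _ _ C S (T \o @displace R)) => [x _|];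
    last first.
    exact: continuous_subspaceW CT Scont.
  apply: (@continuous_comp _ _ _ (@displace R) T).
    exact: displace_continuous.
  exact: Tcont.
have [||||u [uC unull]] := wX C _ _ _ _ f fC fcont.
- by exists 0; exists 0; rewrite /= ?linear0 ?normr0.
- exact: ell1_image_closed c0 Tc TK.
- exact: linear_image_convex.
- exists (K * 4); split=> [|M KM _ [a a4 <-]]; first exact: num_real.
  by rewrite /= (le_trans (TK a))// (le_trans _ (ltW KM))// ler_pM2l.
have /choice[a aP] : forall n, exists a, T a = u n.
  by move=> n; have [a _ <-] := uC n; exists a.
pose v n := a n - displace (a n).
have vE n : u n - f (u n) = T (v n) by rewrite /f -aP TS linearB.
have [|n] := @schur_not_bounded_below R v _ (1 / 8) ltac:(by rewrite divr_gt0).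
  move=> b b1; have [phi [phic phiT]] := extend_comb c0 Tc b1.
  have := unull phi phic; rewrite linear0.
  by under eq_cvg do rewrite vE phiT.
by rewrite ltNge displace_far.
Qed.

Theorem theorem1p1 (R : realType) (X : completeNormedModType R) :
  weak_afpp X <-> ~ contains_isomorphic_copy (ell1 R) X.
Proof.
split; [exact: no_ell1_of_weak_afpp|exact: weak_afpp_of_no_ell1].
Qed.
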